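(* Let $d\ge1$, and let $M\ge2$ and $1\le N\le M^d$ be integers. Let $E\subset[0,1]^d$ be the random Cantor set with $M_k=M$ and $N_k=N$ for all $k\in\mathbb{N}$, as described in the context. Let $F$ be a Borel subset of $[0,1]^d$ with $\dim_H F=\alpha$, and let $s=\log N/\log M$. Then: (1) If $\alpha<d-s$, then almost surely $E\cap F$ is empty. (2) If $\alpha>d-s$, then $E$ intersects $F$ with positive probability. (3) If $\alpha>d-s$, then $\|\dim_H(E\cap F)\|_\infty=\alpha+s-d$, where the norm is the essential supremum in the underlying probability space.
   Context: Random Cantor set: let $\mathcal{D}_n$ be the family of closed cubes $\prod_{\ell=1}^d[i_\ell M^{-n},(i_\ell+1)M^{-n}]$ with integers $0\le i_\ell\le M^n-1$. Choose $N$ distinct cubes of $\mathcal{D}_1$ uniformly at random without replacement; $E_1$ is their union. Given $E_n$ (a union of $N^n$ chosen cubes of $\mathcal{D}_n$), inside each chosen cube choose $N$ distinct cubes among its $M^d$ subcubes in $\mathcal{D}_{n+1}$ uniformly at random without replacement, independently for different cubes of $E_n$; $E_{n+1}$ is the union of all chosen cubes. Then $E=\bigcap_{n\ge1}E_n$. $\dim_H$ is Hausdorff dimension. *)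

(* Defs.v *)
From HB Require Import structures.
From mathcomp Require Import all_boot all_order all_algebra.
From mathcomp Require Import all_classical all_reals all_analysis.

Set Implicit Arguments.
Unset Strict Implicit.
Unset Printing Implicit Defensive.

Import Order.TTheory GRing.Theory Num.Theory.
Import numFieldNormedType.Exports.

Local Open Scope classical_set_scope.
Local Open Scope ring_scope.

Section Hausdorff.
Context {R : realType} {d : nat}.
Implicit Types (A U : set 'rV[R]_d) (t : R).

(* The library norm on 'rV[R]_d is the sup norm. *)
Definition eucl_dist (x y : 'rV[R]_d) : R :=
  Num.sqrt (\sum_(l < d) (x ord0 l - y ord0 l) ^+ 2).

(* The element 0 is added so that the empty set has diameter 0 rather than
   -oo. *)
Definition diameter A : \bar R :=
  ereal_sup (0%E |` [set (eucl_dist x y)%:E | x in A & y in A]).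

(* Here 0^0 = 1 for singletons, by the definition of poweR, while the empty set
   contributes 0 even for t = 0. *)
Definition diameter_pow t U : \bar R :=
  if U == set0 then 0%E else poweR (diameter U) t.

Definition hausdorff_premeasure t (delta : R) A : \bar R :=
  ereal_inf [set (\sum_(0 <= i <oo) diameter_pow t (U i))%E |
    U in [set U : (set 'rV[R]_d)^nat |
      A `<=` \bigcup_i U i /\ forall i, (diameter (U i) <= delta%:E)%E]].

(* The premeasure is nonincreasing in delta, so that the supremum is the limit
   as delta tends to 0. *)
Definition hausdorff_measure t A : \bar R :=
  ereal_sup [set hausdorff_premeasure t delta A | delta in [set e : R | 0 < e]].

Definition hausdorff_dim A : \bar R :=
  ereal_inf [set t%:E |
    t in [set t : R | 0 <= t /\ hausdorff_measure t A = 0%E]].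

Definition borel_set A : Prop := <<s [set U | open U] >> A.

Definition unit_cube : set 'rV[R]_d :=
  [set x | forall l, 0 <= x ord0 l <= 1].

End Hausdorff.

(* The family D_n, a cube being represented by its index (i_l)_{l < d}. *)
Notation cube_index d M n := {ffun 'I_d -> 'I_(M ^ n)}.

Section Cubes.
Context {R : realType} {d M : nat}.

Definition cube n (Q : cube_index d M n) : set 'rV[R]_d :=
  [set x | forall l,
    (Q l)%:R * M%:R ^- n <= x ord0 l <= (Q l).+1%:R * M%:R ^- n].

(* The cubes of D_(n+1) contained in the cube Q of D_n: an index i' lies below
   i when i' = M * i + j for some 0 <= j < M. *)
Definition subcubes n (Q : cube_index d M n) : {set cube_index d M n.+1} :=
  [set Q' : cube_index d M n.+1 |
    [forall l, (Q' l %/ M)%N == Q l :> nat]]%SET.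

Definition cubes_union n (C : {set cube_index d M n}) : set 'rV[R]_d :=
  \bigcup_(Q in [set` C]) cube Q.

Definition cantor_limit (C : forall n, {set cube_index d M n}) : set 'rV[R]_d :=
  \bigcap_(n in [set n | (0 < n)%N]) cubes_union (C n).

End Cubes.

Definition cond_prob {R : realType} {disp : measure_display}
    {T : measurableType disp} (P : probability T R) (A B : set T) : R :=
  fine (P (A `&` B)) / fine (P B).

Section RandomCantor.
Context {R : realType} {disp : measure_display} {T : measurableType disp}.
Context {d M : nat}.
Implicit Type C : forall n, T -> {set cube_index d M n}.

Definition chosen_at C n (A : {set cube_index d M n}) : set T :=
  [set w | C n w = A].

Definition chosen_in C n (Q : cube_index d M n)
    (S : {set cube_index d M n.+1}) : set T :=
  [set w | (C n.+1 w :&: subcubes Q)%SET = S].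

(* [C n w] is the collection of the cubes of D_n whose union is E_n. The
   process starts from the single cube of D_0, i.e., [0,1]^d, so that the choice
   of E_1 is the step n = 0. Since N >= 1, the collection C n determines
   C 0, ..., C n.-1: conditioning on C n is conditioning on the whole past. *)
Record random_cantor (P : probability T R) (N : nat) C : Prop := {
  random_cantor_measurable : forall n (A : {set cube_index d M n}),
    measurable (chosen_at C A);
  random_cantor_init : forall w, C 0%N w = [set: cube_index d M 0]%SET;
  random_cantor_nested : forall n w (Q' : cube_index d M n.+1),
    Q' \in C n.+1 w -> exists2 Q, Q \in C n w & Q' \in subcubes Q;
  random_cantor_card : forall n w (Q : cube_index d M n),
    Q \in C n w -> #|(C n.+1 w :&: subcubes Q)%SET| = N;
  random_cantor_uniform : forall n (A : {set cube_index d M n})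
      (Q : cube_index d M n) (S : {set cube_index d M n.+1}),
    (0 < P (chosen_at C A))%E -> Q \in A ->
    S \subset subcubes Q -> #|S| = N ->
    cond_prob P (chosen_in C Q S) (chosen_at C A) = ('C(M ^ d, N)%:R)^-1;
  random_cantor_indep : forall n (A J : {set cube_index d M n})
      (S : cube_index d M n -> {set cube_index d M n.+1}),
    (0 < P (chosen_at C A))%E -> J \subset A ->
    cond_prob P (\bigcap_(Q in [set` J]) chosen_in C Q (S Q)) (chosen_at C A) =
    \prod_(Q in J) cond_prob P (chosen_in C Q (S Q)) (chosen_at C A)
}.

Definition random_cantor_set C (w : T) : set 'rV[R]_d :=
  cantor_limit (fun n => C n w).

End RandomCantor.

(* Main.v *)
Require Import Defs.
From HB Require Import structures.
From mathcomp Require Import all_boot all_order all_algebra.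
From mathcomp Require Import all_classical all_reals all_analysis.
From mathcomp Require Import measurable_realfun ess_sup_inf.
From mathcomp Require Import ring lra zify.

(** A given cube of [D_n] survives with probability [p ^ n], where
    [p = N / M ^ d = M ^ -(d - s)], so that a covering of [F] of [t]-cost [e] by
    cubes leaves a covering of [E] cap [F] of expected [(t - (d - s))]-cost [e];
    this gives (1) and the upper bound in (3).

    For the lower bounds, let [d - s < t < alpha].  Davies' increasing sets
    lemma for the net content and Choquet's capacitability argument, applied to
    [F] as a Suslin set, give a compact subset [K] of [F] of positive
    [t]-content.  By Frostman's argument on the finite tree of cubes of level at most [n],
    there is a mass distribution on the cubes of level [n] meeting [K], of total
    mass bounded below, with mass at most [M ^ (-t k)] on each cube of level
    [k].
    Restricting it to the surviving cubes and multiplying by [p ^ -n], one gets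
    a random mass of the same mean whose [b]-energy, for [b < t - (d - s)], has
    a mean bounded independently of [n], as two distinct children survive with
    probability at most [p ^ 2].  Hence with probability bounded below, the
    mass is large and its energy bounded, and then any covering of the surviving
    part of [K] has a [b]-cost bounded below.  This happens for infinitely many
    [n] with positive probability, and a compactness argument then bounds
    below the [b]-cost of the coverings of [E] cap [K]. *)

Import Order.TTheory GRing.Theory Num.Theory.
Import numFieldNormedType.Exports.

Local Open Scope classical_set_scope.
Local Open Scope ring_scope.

Set Implicit Arguments.
Unset Strict Implicit.
Unset Printing Implicit Defensive.

(** * Cubes and addresses *)

Section Address.
Context {R : realType} {d M : nat} (hM : (1 < M)%N).
Implicit Types (n k : nat) (y : R) (x : 'rV[R]_d).

Lemma expM_gt0 n : (0 < M ^ n)%N.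
Proof. by rewrite expn_gt0 ltnW. Qed.

(* The truncation at [(M ^ n).-1] puts the right end point [1] in the last
   interval. *)
Definition interval_index n y : nat :=
  minn (Num.truncn (y * M%:R ^+ n)) (M ^ n).-1.

Lemma interval_index_lt n y : (interval_index n y < M ^ n)%N.
Proof.
by rewrite (leq_ltn_trans (geq_minr _ _))// prednK ?expM_gt0.
Qed.

Lemma interval_index_bounds n y : 0 <= y <= 1 ->
  (interval_index n y)%:R * M%:R ^- n <= y <=
  (interval_index n y).+1%:R * M%:R ^- n.
Proof.
move=> /andP[y0 y1].
have Mn : 0 < (M%:R : R) ^+ n by rewrite exprn_gt0// ltr0n ltnW.
have z0 : 0 <= y * M%:R ^+ n by rewrite mulr_ge0// ltW.
rewrite ler_pdivrMr// ler_pdivlMr//; apply/andP; split.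
  by rewrite -truncn_ge_nat// geq_minl.
rewrite /interval_index /minn; case: ifPn => _.
  by rewrite ltW// truncnS_gt.
by rewrite prednK ?expM_gt0// natrX ler_piMl// ltW.
Qed.

(** Dividing the integer part of [y * M ^ n] by [M ^ (n - k)] gives that of [y * M ^ k], and the cap
    [(M ^ n).-1] becomes [(M ^ k).-1]; being monotone, integer division commutes with the
    minimum. *)
Lemma interval_index_ancestor n k y : 0 <= y -> (k <= n)%N ->
  (interval_index n y %/ M ^ (n - k))%N = interval_index k y.
Proof.
move=> y0 kn; set m := (M ^ (n - k))%N.
have m0 : (0 < m)%N by exact: expM_gt0.
have Mk0 := expM_gt0 k.
have En : (M ^ n = M ^ k * m)%N by rewrite -expnD subnKC.
have z0 : 0 <= y * M%:R ^+ k by rewrite mulr_ge0// exprn_ge0// ler0n.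
have trE : (Num.truncn (y * M%:R ^+ n) %/ m)%N = Num.truncn (y * M%:R ^+ k).
  apply/esym/truncn_def; set a := Num.truncn _.
  have /truncn_itv/andP[a1 a2] : 0 <= y * M%:R ^+ n.
    by rewrite mulr_ge0// exprn_ge0// ler0n.
  have EX : y * M%:R ^+ n = y * M%:R ^+ k * m%:R.
    by rewrite -mulrA /m natrX -exprD subnKC.
  rewrite -/a EX in a1 a2.
  have mR : 0 < (m%:R : R) by rewrite ltr0n.
  rewrite -(ler_pM2r mR) -(ltr_pM2r mR) -!natrM; apply/andP; split.
    by rewrite (le_trans _ a1)// ler_nat leq_divM.
  by rewrite (lt_le_trans a2)// ler_nat ltn_ceil.
have predE : ((M ^ n).-1 %/ m)%N = (M ^ k).-1.
  by move: Mk0 m0; rewrite En; nia.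
rewrite /interval_index -trE -predE /minn.
case: (ltnP (Num.truncn _) _) => h; case: ltnP => h' //.
  apply/eqP; rewrite eqn_leq h' andbT.
  exact: leq_div2r (ltnW h).
by apply/eqP; rewrite eqn_leq (leq_div2r _ h)/= ltnW.
Qed.

(** Closed cubes share faces. The address picks one cube of each level containing the point,
    consistently over the levels, so that coverings can be treated on a tree. *)
Definition address n x : cube_index d M n :=
  [ffun l => Ordinal (interval_index_lt n (x ord0 l))].

Lemma ancestor_lt n k (i : 'I_(M ^ n)) : (i %/ M ^ (n - k) < M ^ k)%N.
Proof.
rewrite ltn_divLR ?expM_gt0// (leq_trans (ltn_ord i))// -expnD leq_exp2l//.
by rewrite -leq_subLR.
Qed.

(* Only meaningful for [k <= n]. *)
Definition ancestor n k (Q : cube_index d M n) : cube_index d M k :=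
  [ffun l => Ordinal (ancestor_lt k (Q l))].

Lemma ancestor_trans n k j (Q : cube_index d M n) : (j <= k <= n)%N ->
  ancestor j (ancestor k Q) = ancestor j Q.
Proof.
move=> /andP[jk kn]; apply/ffunP => l; rewrite !ffunE; apply: val_inj => /=.
rewrite ?ffunE/= -divnMA -expnD; congr (_ %/ M ^ _)%N; lia.
Qed.

Lemma subcubesE n (Q : cube_index d M n) (Q' : cube_index d M n.+1) :
  (Q' \in subcubes Q) = (ancestor n Q' == Q).
Proof.
rewrite inE; apply/forallP/eqP => [h|<- l].
  apply/ffunP => l; apply: val_inj; rewrite ffunE/= subSnn expn1.
  by move/eqP: (h l).
by rewrite ffunE /= subSnn expn1.
Qed.

Lemma cube_index0 (Q Q' : cube_index d M 0) : Q = Q'.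
Proof.
apply/ffunP => l; apply: val_inj => /=.
by case: (Q l) (Q' l) => [[|?] ?] [[|?] ?].
Qed.

Lemma address_ancestor n k x : unit_cube x -> (k <= n)%N ->
  ancestor k (address n x) = address k x.
Proof.
move=> xI kn; apply/ffunP => l; rewrite !ffunE; apply: val_inj => /=.
by rewrite ?ffunE/= interval_index_ancestor//; have /andP[] := xI l.
Qed.

Lemma cube_address n x : unit_cube x -> cube (address n x) x.
Proof. by move=> xI l; rewrite ffunE; exact: interval_index_bounds. Qed.

Lemma cube_ancestor n k (Q : cube_index d M n) : (k <= n)%N ->
  cube Q `<=` cube (R := R) (ancestor k Q).
Proof.
move=> kn x Qx l; rewrite ffunE/=.
have M0 : (0 : R) < M%:R by rewrite ltr0n ltnW.
set m := (M ^ (n - k))%N.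
have m0 : (0 < m)%N by exact: expM_gt0.
have -> : (M%:R : R) ^- k = m%:R * M%:R ^- n.
  have -> : (M%:R : R) ^+ n = m%:R * M%:R ^+ k.
    by rewrite /m natrX -exprD subnK.
  by rewrite invfM mulVKf// gt_eqF// ltr0n.
have Mn : (0 : R) < M%:R ^- n by rewrite invr_gt0 exprn_gt0.
have /andP[h1 h2] := Qx l.
rewrite !mulrA -!natrM; apply/andP; split.
  by rewrite (le_trans _ h1)// ler_pM2r// ler_nat leq_divM.
by rewrite (le_trans h2)// ler_pM2r// ler_nat ltn_ceil.
Qed.

End Address.

(** * Net content and increasing sets *)

Section Content.
Context {R : realType} {d M : nat} (hM : (1 < M)%N).
Implicit Types (n k : nat) (q : R) (x : 'rV[R]_d) (A : set 'rV[R]_d).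
Local Notation family := (forall n, {set cube_index d M n}).
Implicit Types U V : family.

Definition cost q U : \bar R := (\sum_(0 <= n <oo) (q ^+ n * #|U n|%:R)%:E)%E.

Lemma cost_ge0 q U : 0 <= q -> (0 <= cost q U)%E.
Proof.
by move=> q0; apply: nneseries_ge0 => n _ _; rewrite lee_fin mulr_ge0// exprn_ge0.
Qed.

Lemma cost_leD q U V U' V' : 0 <= q ->
  (forall n, #|U n| + #|V n| <= #|U' n| + #|V' n|)%N ->
  (cost q U + cost q V <= cost q U' + cost q V')%E.
Proof.
move=> q0 UV; rewrite /cost -!nneseriesD; last first.
- by move=> n _ _; rewrite lee_fin mulr_ge0// exprn_ge0.
- by move=> n _ _; rewrite lee_fin mulr_ge0// exprn_ge0.
- by move=> n _ _; rewrite lee_fin mulr_ge0// exprn_ge0.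
- by move=> n _ _; rewrite lee_fin mulr_ge0// exprn_ge0.
apply: lee_nneseries => n _.
  by rewrite -EFinD lee_fin addr_ge0// mulr_ge0// exprn_ge0.
by rewrite -!EFinD lee_fin -!mulrDr -!natrD ler_wpM2l ?exprn_ge0// ler_nat.
Qed.

Lemma le_cost q U V : 0 <= q -> (forall n, #|U n| <= #|V n|)%N ->
  (cost q U <= cost q V)%E.
Proof.
move=> q0 UV; apply: lee_nneseries => n _.
  by rewrite lee_fin mulr_ge0// exprn_ge0.
by rewrite lee_fin ler_wpM2l ?exprn_ge0// ler_nat.
Qed.

Lemma cost_finite q U m : 0 <= q -> (forall n, (m <= n)%N -> U n = finset.set0) ->
  cost q U = (\sum_(n < m) q ^+ n * #|U n|%:R)%:E.
Proof.
move=> q0 U0; rewrite /cost (nneseries_split 0 m); last first.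
  by move=> n _; rewrite lee_fin mulr_ge0// exprn_ge0.
rewrite eseries0; last by move=> n mn _; rewrite U0// cards0 mulr0.
by rewrite adde0 add0n sumEFin big_mkord.
Qed.

(** Covering through addresses makes two cubes nested or disjoint, as for half-open cubes. The
    content below is then a net content, of dimension [t] for [q = M ^ -t]. *)
Definition address_cover U A := forall x, A x ->
  exists n, address hM n x \in U n.

Definition content q A : \bar R :=
  ereal_inf [set cost q U | U in [set U | address_cover U A]].

Lemma content_le q U A : address_cover U A -> (content q A <= cost q U)%E.
Proof. by move=> UA; apply: ereal_inf_lbound; exists U. Qed.

Lemma content_ge0 q A : 0 <= q -> (0 <= content q A)%E.
Proof. by move=> q0; apply: le_ereal_inf_tmp => _ [U _ <-]; exact: cost_ge0. Qed.

Lemma le_content q A B : A `<=` B -> (content q A <= content q B)%E.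
Proof.
move=> AB; apply: le_ereal_inf_tmp => _ [U UB <-]; apply: content_le => x /AB.
exact: UB.
Qed.

Lemma content_fin_num q A : 0 <= q -> content q A \is a fin_num.
Proof.
move=> q0; rewrite ge0_fin_numE ?content_ge0//.
pose U : family := fun n => if n is 0 then [set: cube_index d M 0]%SET
  else finset.set0.
have UA : address_cover U A by move=> x _; exists 0%N; rewrite inE.
apply: (le_lt_trans (content_le q UA)).
by rewrite (@cost_finite _ _ 1)// ?ltry//; case.
Qed.

Definition tops U : family := fun n =>
  [set Q in U n | [forall k : 'I_n, ancestor hM k Q \notin U k]]%SET.

Lemma tops_cover U A : A `<=` unit_cube -> address_cover U A ->
  address_cover (tops U) A.
Proof.
move=> AI UA x Ax; have /ex_minnP[n xn nmin] := UA x Ax.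
exists n; rewrite inE xn; apply/forallP => k; apply/negP.
rewrite address_ancestor//; last exact: ltnW.
  by move=> /nmin; rewrite leqNgt ltn_ord.
exact: AI.
Qed.

Definition unionf U V : family := fun n => (U n :|: V n)%SET.

(* Strong subadditivity of the content: two cubes are nested or disjoint, so
   that the maximal cubes of two families cover the union, and the remaining
   ones the intersection. *)
Lemma content_cost_tops q A U V : 0 <= q -> A `<=` unit_cube ->
  address_cover U A -> address_cover V A ->
  (content q A + cost q (tops (unionf U V)) <= cost q (tops U) + cost q V)%E.
Proof.
move=> q0 AI UA VA.
pose below (W : family) n (Q : cube_index d M n) :=
  [exists k : 'I_n, ancestor hM k Q \in W k].
(* At each point the smaller of two covering cubes is kept: the maximal cubes of [U] contained in a
   cube of [V], and the cubes of [V] strictly contained in a cube of [U]. *)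
pose W : family := fun n =>
  ([set Q in tops U n | (Q \in V n) || below V n Q] :|:
   [set Q in V n | below U n Q])%SET.
apply: (@le_trans _ _ (cost q W + cost q (tops (unionf U V)))%E).
  rewrite leeD2r// content_le// => x Ax.
  have xI := AI _ Ax.
  have [j jU] := tops_cover AI UA Ax.
  have [k kV] := VA _ Ax.
  have [jk|kj] := ltnP j k.
    exists k; apply/finset.setUP; right; rewrite inE kV /=; apply/existsP.
    exists (Ordinal jk); rewrite address_ancestor ?(ltnW jk)//=.
    by move: jU; rewrite inE => /andP[].
  exists j; apply/finset.setUP; left; rewrite inE jU /=.
  move: kj; rewrite leq_eqVlt => /predU1P[kj|kj].
    by rewrite -kj kV.
  apply/orP; right; apply/existsP; exists (Ordinal kj).
  by rewrite address_ancestor//= ltnW.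
apply: cost_leD => // n.
have cardE (S : {set cube_index d M n}) : #|S| = (\sum_Q (Q \in S))%N.
  by rewrite -sum1_card big_mkcond.
rewrite !cardE -!big_split/=; apply: leq_sum => Q _.
rewrite !inE.
have bU : [forall k : 'I_n, ancestor hM k Q \notin U k] = ~~ below U n Q.
  by rewrite negb_exists.
have bUV : [forall k : 'I_n, ancestor hM k Q \notin unionf U V k] =
    ~~ below U n Q && ~~ below V n Q.
  rewrite -negb_or; apply/forallP/idP => [h|h k].
    by apply/negP => /orP[] /existsP[k hk]; have := h k; rewrite inE hk ?orbT.
  apply: contra h; rewrite inE => /orP[] hk; apply/orP; [left|right];
    by apply/existsP; exists k.
rewrite bU bUV.
(* The inequality holds cube by cube: membership of [Q] in the four families is decided by these
   four booleans. *)
by case: (Q \in U n); case: (Q \in V n); case: (below U n Q);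
  case: (below V n Q).
Qed.

End Content.

Section IncreasingSets.
Context {R : realType} {d M : nat} (hM : (1 < M)%N).
Implicit Types (n k : nat) (q : R) (x : 'rV[R]_d).
Local Notation family := (forall n, {set cube_index d M n}).

(** There are finitely many cubes of level below [n], so the indices chosen for them are bounded. *)
Lemma family_eventually (U : nat -> family) (W : family) n :
  (forall k Q, Q \in W k -> exists i, Q \in U i k) ->
  exists m, forall k Q, (k < n)%N -> Q \in W k ->
    exists2 i, (i <= m)%N & Q \in U i k.
Proof.
move=> WU.
pose f k Q : nat := if pselect (exists i, Q \in U i k) is left e
  then projT1 (cid e) else 0%N.
exists (\max_(k < n) \max_(Q : cube_index d M k) f k Q) => k Q kn QW.
exists (f k Q).
  apply: leq_trans (leq_bigmax (F := fun k : 'I_n =>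
    \max_(Q : cube_index d M k) f k Q) (Ordinal kn)).
  exact: (leq_bigmax (F := f k)).
by rewrite /f; case: pselect => [e|]; [case: cid|move=> []; exact: WU].
Qed.

(** Davies' increasing sets lemma. Near-optimal coverings of the sets [A m] are united one after the
    other; by strong subadditivity, the maximal cubes of the union cost at most the content of the
    last set plus the accumulated errors. *)
Lemma content_increasing q (A : nat -> set 'rV[R]_d) (c : R) : 0 <= q ->
  (forall m, A m `<=` unit_cube) -> (forall m, A m `<=` A m.+1) ->
  (forall m, (content hM q (A m) <= c%:E)%E) ->
  (content hM q (\bigcup_m A m) <= c%:E)%E.
Proof.
move=> q0 AI Ainc Ac; apply/lee_addgt0Pr => e e0.
pose a m := fine (content hM q (A m)).
have aE m : content hM q (A m) = (a m)%:E by rewrite fineK// content_fin_num.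
have ac m : a m <= c by rewrite -lee_fin -aE.
(* The accumulated error is [t 0 + ... + t m = e - t m], the one that [key] allows. *)
pose t m : R := e / 2 ^+ m.+1.
have t0 m : 0 < t m by rewrite divr_gt0// exprn_gt0.
have tS m : t m = t m.+1 + t m.+1.
  by rewrite /t (exprS _ m.+1); field; rewrite expf_neq0// pnatr_eq0.
have /choice[U UP] m : exists U, address_cover hM U (A m) /\
    (cost q U <= (a m + t m)%:E)%E.
  have : (content hM q (A m) < (a m + t m)%:E)%E.
    by rewrite aE lte_fin ltrDl.
  by move=> /ereal_inf_lt[_ [U UA <-]] /ltW ?; exists U.
pose PP m : family := fun n => [set Q | [exists i : 'I_m.+1, Q \in U i n]]%SET.
pose PI : family := fun n => [set Q | `[< exists i, Q \in U i n >]]%SET.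
have PPcov m : address_cover hM (PP m) (A m).
  move=> x Ax; have [n xn] := (UP m).1 x Ax.
  by exists n; rewrite inE; apply/existsP; exists ord_max.
have PPS m : PP m.+1 = unionf (PP m) (U m.+1).
  apply: functional_extensionality_dep => n; apply/setP => Q; rewrite !inE.
  apply/existsP/orP => [[i]|[/existsP[i Qi]|Qm]].
  - have [->|im Qi] := eqVneq i ord_max; first by right.
    left; apply/existsP.
    have im' : (i < m.+1)%N.
      by rewrite ltn_neqAle -ltnS ltn_ord andbT; apply: contra im.
    by exists (Ordinal im').
  - by exists (widen_ord (leqnSn _) i).
  - by exists ord_max.
have key m : (cost q (tops hM (PP m)) <= (a m + (e - t m))%:E)%E.
  elim: m => [|m IH].
    apply: (@le_trans _ _ (cost q (U 0%N))).
      apply: le_cost => // n; apply: subset_leq_card.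
      apply/fintype.subsetP => Q; rewrite !inE.
      by move=> /andP[/existsP[i]]; rewrite (ord1 i).
    apply: (le_trans (UP 0%N).2); rewrite lee_fin lerD2l.
    by have := tS 0%N; rewrite /t !exprS expr0; lra.
  (* Both families cover [A m], whose content [a m] cancels against the one in the induction
     hypothesis. *)
  have h := content_cost_tops q0 (AI m) (PPcov m)
    (fun x Ax => (UP m.+1).1 x (Ainc m x Ax)).
  rewrite -PPS in h.
  have {h} := le_trans h (leeD IH (UP m.+1).2).
  rewrite aE -EFinD.
  have := @cost_ge0 R d M q (tops hM (PP m.+1)) q0.
  case: (cost _ _) => [z| |] //.
  rewrite -!EFinD !lee_fin => _ h; have := tS m.
  have := tS m.+1; have := t0 m.+1; lra.
pose W := tops hM PI.
have WA : address_cover hM W (\bigcup_m A m).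
  apply: tops_cover; first by move=> x [m _] /AI.
  move=> x [m _ Ax]; have [n xn] := (UP m).1 x Ax.
  by exists n; rewrite inE; apply/asboolP; exists m.
apply: (le_trans (content_le q WA)).
have WU k Q : Q \in W k -> exists i, Q \in U i k.
  by rewrite !inE => /andP[/asboolP].
apply: lime_le.
  apply: is_cvg_nneseries => n _ _.
  by rewrite lee_fin mulr_ge0// exprn_ge0.
apply: nearW => n.
(* The maximal cubes of the infinite union that have level less than [n] are already maximal in a
   finite union [PP m], so that [key] bounds each partial sum. *)
have [m mW] := family_eventually n WU.
apply: (@le_trans _ _ (cost q (tops hM (PP m)))).
  apply: (@le_trans _ _ (cost q
      ((fun k => if (k < n)%N then W k else finset.set0) : family))).
    rewrite (@cost_finite _ _ _ _ _ n)//; last first.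
      by move=> k nk; rewrite ltnNge nk.
    rewrite big_mkord sumEFin lee_fin; apply: ler_sum => k _.
    by rewrite ltn_ord.
  apply: le_cost => // k; apply: subset_leq_card; apply/fintype.subsetP => Q.
  case: ifP => [kn QW|_]; last by rewrite inE.
  have [i im Qi] := mW _ _ kn QW.
  rewrite !inE; apply/andP; split.
    by apply/existsP; exists (Ordinal (im : (i < m.+1)%N)).
  apply/forallP => j; move: QW; rewrite !inE => /andP[_ /forallP/(_ j)].
  apply: contra; rewrite !inE => /existsP[l Ql];
  do 2 apply/asboolP; by exists (nat_of_ord l).
apply: (le_trans (key m)); rewrite -EFinD lee_fin.
by have := ac m; have := t0 m; lra.
Qed.

End IncreasingSets.

(** * Capacitability of Borel sets *)

(** [V] and the complements of the [L n] form an open cover of [B]; the largest index in a finite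
    subcover is suitable. *)
Lemma compact_decreasing (X : ptopologicalType) (B V : set X)
    (L : nat -> set X) : compact B -> open V ->
  (forall n, closed (L n)) -> (forall n, L n.+1 `<=` L n) ->
  B `&` \bigcap_n L n `<=` V -> exists n, B `&` L n `<=` V.
Proof.
rewrite compact_cover => Bc oV Lc Ldec BLV.
have Lle n m : (n <= m)%N -> L m `<=` L n.
  move=> /subnK <-; elim: (m - n)%N => [//|k IH] x; rewrite addSn => /Ldec.
  exact: IH.
have [||D _ BD] := Bc nat setT (fun n => V `|` ~` L n).
- by move=> n _; apply: openU => //; exact: closed_openC.
- move=> x Bx; have [|] := pselect (forall n, L n x).
    by move=> Lx; exists 0%N => //; left; apply: BLV; split => // n _; exact: Lx.
  by move=> /existsNP[n Lnx]; exists n => //; right.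
exists (\max_(n <- finmap.enum_fset D) n) => x [Bx Lx].
have [n /= nD [//|/(_ _)[]]] := BD x Bx.
by apply: Lle Lx; exact: leq_bigmax_seq.
Qed.

Section PrefixChoice.

Definition upd (f : nat -> nat) (k m : nat) : nat -> nat :=
  fun i => if i == k then m else f i.

(** Dependent choice of the terms of a sequence, used both for the branch in König's lemma and for
    the bounding sequence in the capacitability argument. *)
Lemma prefix_choice (Q : nat -> (nat -> nat) -> Prop) :
  (forall k f g, (forall i, (i < k)%N -> f i = g i) -> Q k f -> Q k g) ->
  Q 0%N (fun=> 0%N) ->
  (forall k f, Q k f -> exists m, Q k.+1 (upd f k m)) ->
  exists f, forall k, Q k f.
Proof.
move=> Qloc Q0 QS.
have /choice[step stepP] (p : nat * (nat -> nat)) :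
    exists m, Q p.1 p.2 -> Q p.1.+1 (upd p.2 p.1 m).
  have [/QS[m Qm]|nQ] := pselect (Q p.1 p.2); first by exists m.
  by exists 0%N.
pose fix s k := if k is k'.+1 then upd (s k') k' (step (k', s k')) else fun=> 0%N.
have Qs k : Q k (s k) by elim: k => [//|k IH]; exact: (stepP (k, s k)).
exists (fun i => s i.+1 i) => k; apply: Qloc (Qs k) => i.
elim: k => [//|k IH]; rewrite ltnS leq_eqVlt => /predU1P[->//|ik] /=.
by rewrite [in LHS]/upd ltn_eqF// IH.
Qed.

End PrefixChoice.

(** * The Suslin operation on closed sets *)

Section Suslin.
Context {X : topologicalType}.
Implicit Types (A : set X) (G : nat -> (nat -> nat) -> set X) (b f g : nat -> nat).

Definition local G (h : nat -> nat) := forall n f g,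
  (forall i, (i < h n)%N -> f i = g i) -> G n f = G n g.

(* The result of the Suslin operation on closed sets; [G n f] stands for the
   closed set indexed by the first [n] terms of [f]. *)
Definition suslin A := exists G, [/\ forall n f, closed (G n f), local G id &
  A = [set x | exists f, forall n, G n f x]].

(** Normalizes a scheme whose condition [n] reads [h n] terms: stage [m] imposes the conditions
    [n <= m] that read at most [m] terms. *)
Lemma suslin_local (G : nat -> (nat -> nat) -> set X) h A :
  (forall n f, closed (G n f)) -> local G h ->
  A = [set x | exists f, forall n, G n f x] -> suslin A.
Proof.
move=> Gc Gl ->.
exists (fun m f => \bigcap_(n in [set n | (n <= m)%N && (h n <= m)%N]) G n f).
split.
- by move=> n f; apply: closed_bigI => i _; exact: Gc.
- move=> m f g fg; apply: eq_bigcapr => n /andP[_ hm].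
  by apply: Gl => i ih; apply: fg; exact: leq_trans hm.
apply/seteqP; split => x [f Gf]; exists f => n; first by move=> k _; exact: Gf.
by apply: (Gf (maxn n (h n))); rewrite /= leq_maxl leq_maxr.
Qed.

Lemma suslin_closed A : closed A -> suslin A.
Proof.
move=> Ac; exists (fun _ _ => A); split => //.
by apply/seteqP; split => x; [exists (fun=> 0%N)|case=> _ /(_ 0%N)].
Qed.

(** The first term of the sequence encodes the index [i], and the remaining ones serve for [A i]. *)
Lemma suslin_bigcup (A : nat -> set X) : (forall i, suslin (A i)) ->
  suslin (\bigcup_i A i).
Proof.
move=> /choice[G GP].
exists (fun n f => if n is m.+1 then G (f 0%N) m (f \o S) else setT); split.
- by move=> [|n] f; [exact: closedT|have [h _ _] := GP (f 0%N); exact: h].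
- move=> [//|n] f g fg; rewrite (fg 0%N)//.
  by have [_ h _] := GP (g 0%N); apply: h => i im; apply: fg.
apply/seteqP; split => x.
  move=> [i _]; have [_ _ ->] := GP i => -[f Gf].
  by exists (fun j => if j is j'.+1 then f j' else i) => -[//|n]; exact: Gf.
move=> [f Gf]; exists (f 0%N) => //; have [_ _ ->] := GP (f 0%N).
by exists (f \o S) => n; exact: (Gf n.+1).
Qed.

(** Through a pairing function, one sequence encodes a sequence for each [A k], and the number [n]
    of a condition encodes a pair [(k, m)], standing for condition [m] of [A k]. *)
Lemma suslin_bigcap (A : nat -> set X) : (forall i, suslin (A i)) ->
  suslin (\bigcap_i A i).
Proof.
move=> /choice[G GP].
pose part (f : nat -> nat) (k : nat) : nat -> nat := fun i => f (pickle (k, i)).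
pose u (n : nat) : option (nat * nat) := unpickle n.
apply: (@suslin_local (fun n f => if u n is Some (k, m)
    then G k m (part f k) else setT)
  (fun n => if u n is Some (k, m)
    then (\max_(i < m) (pickle (k, nat_of_ord i)).+1)%N else 0%N)).
- move=> n f; case: (u n) => [[k m]|]; last exact: closedT.
  by have [h _ _] := GP k; exact: h.
- move=> n f g /=; case: (u n) => [[k m]|//] fg.
  have [_ h _] := GP k.  apply: (h m) => i im; apply: fg.
  exact: (leq_bigmax (F := fun i : 'I_m => (pickle (k, nat_of_ord i)).+1)
    (Ordinal im)).
apply/seteqP; split => x.
  move=> Ax; have /choice[f fP] k : exists f, forall n, G k n f x.
    by have := Ax k I; have [_ _ ->] := GP k.
  exists (fun j => if u j is Some (k, i) then f k i else 0%N) => n.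
  case: (u n) => [[k m]|//].
  rewrite (_ : part _ k = f k)//.
  by apply: functional_extensionality_dep => i; rewrite /part /u pickleK.
move=> [f Gf] k _; have [_ _ ->] := GP k; exists (part f k) => n.
by have := Gf (pickle (k, n)); rewrite /u pickleK.
Qed.

(** Finitely many prefixes of length [m] respect the bounds, so this is a finite union of closed
    sets. The induction splits off the first term. *)
Lemma closed_bounded_exists b m (P : (nat -> nat) -> set X) :
  (forall f, closed (P f)) ->
  (forall f g, (forall i, (i < m)%N -> f i = g i) -> P f = P g) ->
  closed [set x | exists2 f, (forall i, f i <= b i)%N & P f x].
Proof.
elim: m b P => [|m IH] b P Pc Pl.
  rewrite (_ : [set x | _] = P (fun=> 0%N))//; apply/seteqP; split => x /=.
    by move=> [f _]; rewrite (Pl f (fun=> 0%N)).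
  by exists (fun=> 0%N).
pose cons a f : nat -> nat := fun i => if i is j.+1 then f j else a.
rewrite (_ : [set x | _] = \bigcup_(a in `I_(b 0%N).+1)
    [set x | exists2 f, (forall i, f i <= b i.+1)%N & P (cons a f) x]).
  apply: closed_bigcup; first exact: finite_II.
  move=> a _; apply: (IH (b \o S) (P \o cons a)) => [f|f g fg].
    exact: Pc.
  by apply: Pl => -[//|i]; exact: fg.
apply/seteqP; split => x.
  move=> [f fb Pf]; exists (f 0%N) => /=; first by rewrite ltnS.
  exists (f \o S) => [i|]; first exact: fb.
  by rewrite (Pl _ f)// => -[].
move=> [a /= ab [f fb Pf]]; exists (cons a f) => //.
by case=> [|i] /=; [rewrite -ltnS|exact: fb].
Qed.

(* König's lemma *)
Lemma bigcap_bounded_exists b G : local G id ->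
  \bigcap_k [set x | exists2 f, (forall i, f i <= b i)%N &
    forall n, (n <= k)%N -> G n f x] `<=`
  [set x | exists2 f, (forall i, f i <= b i)%N & forall n, G n f x].
Proof.
move=> Gl x Lx.
(* The prefix of length [k] extends to bounded sequences satisfying arbitrarily many conditions. If
   no next term kept this property, the finitely many candidates up to [b k] would all fail at a
   common stage. *)
pose Q k f := forall j, exists g, [/\ (forall i, g i <= b i)%N,
  forall i, (i < k)%N -> g i = f i & forall n, (n <= j)%N -> G n g x].
have [|||f fQ] := @prefix_choice Q.
- move=> k f g fg Qf j; have [e [eb ef Ge]] := Qf j.
  by exists e; split => // i ik; rewrite ef// fg.
- by move=> j; have [f fb Gf] := Lx j I; exists f.
- move=> k f Qf; apply: contrapT => /forallNP nQ.
  have /choice[J JP] m : exists j, ~ exists g, [/\ (forall i, g i <= b i)%N,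
      forall i, (i < k.+1)%N -> g i = upd f k m i &
      forall n, (n <= j)%N -> G n g x].
    by apply/existsNP; exact: nQ.
  have [g [gb gf Gg]] := Qf (\max_(m < (b k).+1) J m)%N.
  apply: (JP (g k)); exists g; split => // [i|n nJ].
    rewrite ltnS leq_eqVlt /upd => /predU1P[->|ik]; first by rewrite eqxx.
    by rewrite ltn_eqF// gf.
  apply: Gg; apply: (leq_trans nJ).
  have gk : (g k < (b k).+1)%N by rewrite ltnS.
  exact: (leq_bigmax (F := fun m : 'I__ => J m) (Ordinal gk)).
exists f => [i|n].
  by have [g [gb gf _]] := fQ i.+1 0%N; rewrite -gf.
by have [g [gb gf Gg]] := fQ n n; rewrite -(Gl n g)//; exact: Gg.
Qed.

End Suslin.

(** [F n] consists of the points at distance at least [1 / (n + 1)] from the complement. *)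
Lemma open_bigcup_closed {K : realType} (V : pseudoMetricNormedZmodType K)
    (U : set V) : open U ->
  exists F : nat -> set V, (forall n, closed (F n)) /\ U = \bigcup_n F n.
Proof.
move=> oU.
exists (fun n => ~` \bigcup_(y in ~` U) ball y n.+1%:R^-1); split.
  move=> n; apply: open_closedC; apply: bigcup_open => y _; exact: ball_open.
apply/seteqP; split => x.
  move=> Ux; have /nbhs_ballP[e /= e0 eU] := open_nbhs_nbhs (conj oU Ux).
  exists (Num.truncn e^-1) => // -[y nUy] yx; apply: nUy; apply: eU.
  apply: ball_sym; apply: le_ball yx.
  by rewrite -[leRHS]invrK lef_pV2 ?posrE ?invr_gt0// ltW// truncnS_gt.
move=> [n _ nx]; apply: contrapT => nUx; apply: nx; exists x => //.
exact: ballxx.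
Qed.

(** The complement of a Suslin set need not be Suslin; the sets that are Suslin together with their
    complement form a sigma-algebra containing the open sets. *)
Lemma borel_suslin {R : realType} {d : nat} (A : set 'rV[R]_d) :
  borel_set A -> suslin A.
Proof.
pose S : set (set 'rV[R]_d) := [set B | suslin B /\ suslin (~` B)].
suff : <<s [set U | open U] >> `<=` S by move=> h /h[].
apply: smallest_sub.
  split=> [|B [SB SCB]|B SB].
  - split; apply: suslin_closed; first exact: closed0.
    by rewrite setC0; exact: closedT.
  - by rewrite setTD; split => //; rewrite setCK.
  - split; first by apply: suslin_bigcup => i; have [] := SB i.
    by rewrite setC_bigcup; apply: suslin_bigcap => i; have [] := SB i.
move=> U oU; split; last by apply: suslin_closed; exact: open_closedC.
have [F [Fc ->]] := open_bigcup_closed oU.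
by apply: suslin_bigcup => i; exact: suslin_closed.
Qed.

Lemma unit_cube_compact {R : realType} {d : nat} :
  compact (unit_cube : set 'rV[R]_d).
Proof.
rewrite (_ : unit_cube = [set v : 'rV[R]_d | forall i, `[0, 1]%classic (v ord0 i)]).
  by apply: (@rV_compact R d (fun=> `[0, 1]%classic)) => i; exact: segment_compact.
by apply/seteqP; split => x xI l; have := xI l; rewrite /= in_itv.
Qed.

Section Capacitability.
Context {R : realType} {d M : nat} (hM : (1 < M)%N).

(** By the increasing sets lemma, the terms of the codes can be bounded one after the other while
    the content stays above [c]. The points with a code bounded by [b] form [K], which by König's
    lemma is the intersection of the closed sets [L k]; an open set containing [K] thus contains
    some [L k] within the unit cube. Coverings by cubes are not open, hence the form of the
    conclusion. *)
Lemma content_capacitable (q c : R) (A : set 'rV[R]_d) : 0 <= q ->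
  A `<=` unit_cube -> suslin A -> (c%:E < content hM q A)%E ->
  exists K, [/\ closed K, K `<=` A & forall V, open V -> K `<=` V ->
    (c%:E < content hM q (V `&` unit_cube))%E].
Proof.
move=> q0 AI [G [Gc Gl AE]] cA.
pose S b k := [set x | exists2 f, (forall i, (i < k)%N -> (f i <= b i)%N) &
  forall n, G n f x].
have SA b k : S b k `<=` A by move=> x [f _ Gf]; rewrite AE; exists f.
have [|||b bP] := @prefix_choice (fun k b => (c%:E < content hM q (S b k))%E).
- move=> k f g fg; rewrite (_ : S g k = S f k)//.
  by apply/seteqP; split => x [e eb Ge]; exists e => // i ik;
    [rewrite fg|rewrite -fg]; rewrite ?eb.
- rewrite (_ : S _ _ = A)//; apply/seteqP; split; first exact: SA.
  by rewrite AE => x [f Gf]; exists f.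
- move=> k f cS; apply: contrapT => /forallNP nc.
  suff : (content hM q (\bigcup_m S (upd f k m) k.+1) <= c%:E)%E.
    rewrite leNgt => /negP; apply; apply: (lt_le_trans cS).
    apply: le_content => x [e ef Ge]; exists (e k) => //; exists e => // i.
    rewrite ltnS leq_eqVlt /upd => /predU1P[->|ik]; first by rewrite eqxx.
    by rewrite ltn_eqF// ef.
  apply: content_increasing => // [m|m x [e em Ge]|m].
  + exact: subset_trans (SA _ _) AI.
  + exists e => // i ik; apply: (leq_trans (em i ik)).
    by rewrite /upd; case: eqP.
  + by rewrite leNgt; apply/negP; exact: nc.
pose L k := [set x | exists2 f, (forall i, f i <= b i)%N &
    forall n, (n <= k)%N -> G n f x].
pose K := [set x | exists2 f, (forall i, f i <= b i)%N & forall n, G n f x].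
have LK : \bigcap_k L k = K.
  apply/seteqP; split; first exact: bigcap_bounded_exists.
  by move=> x [f fb Gf] k _; exists f.
have Lc k : closed (L k).
  pose P f := \bigcap_(n in [set n | (n <= k)%N]) G n f.
  rewrite (_ : L k = [set x | exists2 f, (forall i, f i <= b i)%N & P f x])//.
  apply: (@closed_bounded_exists _ b k P) => [f|f g fg].
    by apply: closed_bigI => n _; exact: Gc.
  apply: eq_bigcapr => n /= nk; apply: Gl => i ik.
  by apply: fg; exact: leq_trans nk.
exists K; split.
- by rewrite -LK; apply: closed_bigI => k _; exact: Lc.
- by rewrite AE => x [f _ Gf]; exists f.
move=> V oV KV.
have [||k Lk] := compact_decreasing unit_cube_compact oV Lc.
- by move=> n x [f fb Gf]; exists f => // m mn; apply: Gf; exact: leqW.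
- by rewrite LK => x [_ /KV].
apply: (lt_le_trans (bP k)); apply: le_content => x Sx.
have xI : unit_cube x by apply: AI; exact: SA Sx.
split => //; apply: Lk; split => //.
have [f fb Gf] := Sx.
(* The terms from [k] on, which [S b k] leaves unbounded, are not read by the conditions of [L k]
   and are reset to 0. *)
exists (fun i => if (i < k)%N then f i else 0%N) => [i|n nk].
  by case: ifPn => // /fb.
by rewrite (Gl n _ f)// => i ik; rewrite (leq_trans ik nk).
Qed.

End Capacitability.

(** * Hausdorff measure and coverings by cubes *)

Section Series.
Context {R : realType}.
Implicit Types (c : R).

Lemma nneseries_single (k : nat) c : 0 <= c ->
  (\sum_(0 <= n <oo) (if n == k then c else 0)%:E = c%:E)%E.
Proof.
move=> c0; rewrite (@nneseriesD1 _ _ k)//; last by move=> n _; case: ifP; rewrite lee_fin.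
rewrite eqxx eseries0 ?adde0// => n _.
by rewrite andTb => /negbTE ->.
Qed.

Lemma nneseries_const (m : nat) c : 0 <= c ->
  (\sum_(0 <= n <oo) (if (n < m)%N then c else 0)%:E = (c * m%:R)%:E)%E.
Proof.
move=> c0; rewrite (nneseries_split 0 m); last first.
  by move=> n _; case: ifP; rewrite lee_fin.
rewrite eseries0; last by move=> n; rewrite add0n => mn _; rewrite ltnNge mn.
rewrite adde0 add0n big_mkord sumEFin (eq_bigr (fun=> c)).
  by rewrite sumr_const card_ord mulr_natr.
by move=> i _; rewrite ltn_ord.
Qed.

Lemma le_nneseries_term (u : nat -> \bar R) n : (forall i, 0 <= u i)%E ->
  (u n <= \sum_(0 <= i <oo) u i)%E.
Proof. by move=> u0; rewrite (@nneseriesD1 _ _ n)// leeDl// nneseries_ge0. Qed.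

End Series.

Section Scales.
Context {R : realType} {d M : nat} (hM : (1 < M)%N).
Implicit Types (t e D : R) (x y : 'rV[R]_d) (A : set 'rV[R]_d).
Local Notation family := (forall n, {set cube_index d M n}).

(** As the parameter [q] of [cost], it weights a cube by the [t]-th power of its side. *)
Definition scale_weight t : R := M%:R `^ (- t).

Let M0 : (0 : R) < M%:R. Proof. by rewrite ltr0n ltnW. Qed.
Let M1 : (1 : R) < M%:R. Proof. by rewrite ltr1n. Qed.

Lemma side_ge0 n : 0 <= (M%:R : R) ^- n.
Proof. by rewrite invr_ge0 exprn_ge0// ltW. Qed.

Lemma scale_weight_gt0 t : 0 < scale_weight t.
Proof. exact: powR_gt0. Qed.

Lemma scale_weightE t n : scale_weight t ^+ n = (M%:R ^- n) `^ t.
Proof.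
rewrite -(powR_invn n (ltW M0)) -(powR_mulrn n (powR_ge0 _ _)) -!powRrM.
by rewrite mulNr mulrC mulNr.
Qed.

Lemma side_lt e : 0 < e -> exists n, (M%:R : R) ^- n < e.
Proof.
move=> e0.
have /cvgrPdist_lt/(_ _ e0)[n _ /(_ n (leqnn n))] :
    (fun n => M%:R^-1 ^+ n) @ \oo --> (0 : R).
  by apply: cvg_expr; rewrite ger0_norm ?invr_ge0 ?ltW// invf_lt1.
rewrite sub0r normrN ger0_norm ?exprn_ge0 ?invr_ge0 ?ltW// exprVn => ne.
by exists n.
Qed.

Lemma scale_weight_lt t e : 0 < t -> 0 < e -> exists n, scale_weight t ^+ n < e.
Proof.
move=> t0 e0; have [n ne] := @side_lt (e `^ t^-1) (powR_gt0 _ e0).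
exists n; rewrite scale_weightE -[ltRHS]powRr1 ?ltW//.
rewrite -[X in e `^ X](mulVf (lt0r_neq0 t0)) powRrM.
by apply: gt0_ltr_powR => //; rewrite nnegrE ?powR_ge0 ?invr_ge0 ?exprn_ge0 ?ltW.
Qed.

Lemma side_between D : 0 < D <= 1 ->
  exists k, D <= (M%:R : R) ^- k <= M%:R * D.
Proof.
move=> /andP[D0 D1].
have [n nD] := side_lt D0.
have /ex_minnP[[|k] kD kmin] : exists n, (M%:R : R) ^- n < D by exists n.
  by move: kD; rewrite expr0 invr1 ltNge D1.
exists k; apply/andP; split.
  by rewrite leNgt; apply/negP => /kmin; rewrite ltnn.
have -> : (M%:R : R) ^- k = M%:R * M%:R ^- k.+1.
  by rewrite exprS invfM mulVKf// gt_eqF.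
by rewrite ler_pM2l// ltW.
Qed.

Lemma eucl_dist_le x y e : 0 <= e -> (forall l, `|x ord0 l - y ord0 l| <= e) ->
  eucl_dist x y <= Num.sqrt d%:R * e.
Proof.
move=> e0 xy; rewrite /eucl_dist -[in leRHS](ger0_norm e0) -sqrtr_sqr -sqrtrM//.
apply: ler_wsqrtr; rewrite mulr_natl -[in leRHS](card_ord d) -sumr_const.
apply: ler_sum => l _; rewrite -real_normK ?num_real// ler_sqr ?nnegrE//.
Qed.

Lemma coord_le_eucl_dist x y l : `|x ord0 l - y ord0 l| <= eucl_dist x y.
Proof.
rewrite /eucl_dist -sqrtr_sqr; apply: ler_wsqrtr.
by rewrite (bigD1 l)//= lerDl sumr_ge0// => i _; exact: sqr_ge0.
Qed.

Lemma diameter_ge0 A : (0 <= diameter A)%E.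
Proof. by apply: ereal_sup_ubound; left. Qed.

Lemma diameter0 : diameter (set0 : set 'rV[R]_d) = 0%E.
Proof.
apply/eqP; rewrite eq_le diameter_ge0 andbT; apply: ge_ereal_sup.
by move=> _ [->//|[x []]].
Qed.

Lemma diameter_cube n (Q : cube_index d M n) :
  (diameter (cube Q : set 'rV[R]_d) <= (Num.sqrt d%:R * M%:R ^- n)%:E)%E.
Proof.
have e0 := side_ge0 n.
apply: ge_ereal_sup => _ [->|[x Qx [y Qy <-]]]; rewrite lee_fin.
  by rewrite mulr_ge0// sqrtr_ge0.
apply: eucl_dist_le => // l; have /andP[] := Qx l; have /andP[] := Qy l.
rewrite -natr1 !mulrDl !mul1r ler_norml; lra.
Qed.

Lemma diameter_pow_ge0 t A : (0 <= diameter_pow t A)%E.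
Proof. by rewrite /diameter_pow; case: ifP => // _; exact: poweR_ge0. Qed.

Lemma diameter_pow_le t A e : 0 <= t -> 0 <= e -> (diameter A <= e%:E)%E ->
  (diameter_pow t A <= (e `^ t)%:E)%E.
Proof.
move=> t0 e0 Ae; rewrite /diameter_pow; case: ifP => _; first by rewrite lee_fin powR_ge0.
rewrite -poweR_EFin; apply: gt0_ler_poweR => //;
by rewrite in_itv/= ?lee_fin ?diameter_ge0 ?leey ?e0.
Qed.

Lemma rV_ballP y e x : ball y e x <-> 0 < e /\
  forall l, `|y ord0 l - x ord0 l| < e.
Proof.
split=> -[e0 h]; split => //; first by move=> l; exact: h.
by move=> i l; rewrite (ord1 i); exact: h.
Qed.

(** For [t > 0] a covering of small cost contains only small cubes, so that the bound [delta] on the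
    diameters comes for free. The rest compares diameters with sides and enumerates the family. *)
Lemma hausdorff_null_of_cubes t A : 0 < t ->
  (forall e, 0 < e -> exists2 U : family,
    (forall x, A x -> exists n (Q : cube_index d M n), Q \in U n /\ cube Q x) &
    (cost (scale_weight t) U <= e%:E)%E) ->
  hausdorff_measure t A = 0%E.
Proof.
move=> t0 AU; apply/eqP; rewrite eq_le; apply/andP; split; last first.
  apply: le_ereal_sup_tmp; exists (hausdorff_premeasure t 1 A).
    by exists 1 => //=.
  apply: le_ereal_inf_tmp => _ [U _ <-].
  by apply: nneseries_ge0 => i _ _; exact: diameter_pow_ge0.
apply: ge_ereal_sup => _ [dl /= dl0 <-]; apply/lee_addgt0Pr => eta eta0.
rewrite add0e.
(* The added 1 keeps [c] positive for [d = 0] too. *)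
pose c : R := Num.sqrt d%:R + 1.
have c0 : 0 < c by rewrite ltr_wpDl// sqrtr_ge0.
have ct0 : 0 < c `^ t by exact: powR_gt0.
(* The first bound makes the sum at most [eta], the second one makes the diameters at most [dl]. *)
pose e := Num.min (eta / c `^ t) ((dl / c) `^ t).
have e0 : 0 < e by rewrite lt_min divr_gt0//= powR_gt0// divr_gt0.
have [U UA Ue] := AU _ e0.
have U_small n : U n != finset.set0 -> c * M%:R ^- n <= dl.
  move=> Un; rewrite mulrC -ler_pdivlMr//.
  rewrite leNgt; apply/negP => h.
  have : (dl / c) `^ t < scale_weight t ^+ n.
    by rewrite scale_weightE; apply: gt0_ltr_powR => //;
      rewrite nnegrE ?side_ge0// ltW// divr_gt0.
  apply/negP; rewrite -leNgt -lee_fin; apply: (@le_trans _ _ e%:E); last first.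
    by rewrite lee_fin ge_min lexx orbT.
  apply: le_trans Ue; apply: (@le_trans _ _ (scale_weight t ^+ n * #|U n|%:R)%:E).
    rewrite lee_fin; apply: ler_peMr; first by rewrite exprn_ge0 ?powR_ge0.
    by rewrite ler1n lt0n cards_eq0.
  apply: le_nneseries_term => i.
  by rewrite lee_fin mulr_ge0// exprn_ge0// ltW// scale_weight_gt0.
pose V (p : nat * nat) : set 'rV[R]_d :=
  oapp (fun Q => cube Q) set0 (onth (fintype.enum (U p.1)) p.2).
pose w (p : nat * nat) : \bar R :=
  (if (p.2 < #|U p.1|)%N then c `^ t * scale_weight t ^+ p.1 else 0)%:E.
have w0 p : (0 <= w p)%E.
  by rewrite /w; case: ifP => _; rewrite lee_fin// mulr_ge0 ?exprn_ge0 ?powR_ge0.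
have Vw p : (diameter_pow t (V p) <= w p)%E /\ (diameter (V p) <= dl%:E)%E.
  rewrite /V /w; case E : (onth _ _) => [Q|] /=; last first.
    split; last by rewrite diameter0 lee_fin ltW.
    rewrite /diameter_pow eqxx; exact: w0.
  have pU : (p.2 < #|U p.1|)%N by rewrite cardE -onthTE E.
  have QU : Q \in U p.1 by rewrite -mem_enum; apply/onthP; exists p.2.
  have cM0 : 0 <= c * M%:R ^- p.1.
    by rewrite mulr_ge0 ?side_ge0// ltW.
  have dQ : (diameter (cube Q : set 'rV[R]_d) <= (c * M%:R ^- p.1)%:E)%E.
    apply: (le_trans (diameter_cube Q)); rewrite lee_fin ler_wpM2r ?side_ge0//.
    by rewrite lerDl.
  split; last first.
    apply: (le_trans dQ); rewrite lee_fin U_small//; apply/finset.set0Pn.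
    by exists Q.
  rewrite pU; apply: (le_trans (diameter_pow_le (ltW t0) cM0 dQ)).
  by rewrite lee_fin scale_weightE (powRM _ (ltW c0) (side_ge0 _)).
(* The array of the cubes, padded with empty sets, is read along a bijection from [nat] to
   [nat * nat]. *)
have /card_esym/ppcard_eqP[f] := card_nat2.
apply: (@le_trans _ _ (\sum_(0 <= i <oo) diameter_pow t (V (f i)))%E).
  apply: ereal_inf_lbound; exists (V \o f) => //=; split; last first.
    by move=> i; exact: (Vw _).2.
  move=> x /UA[n [Q [QU Qx]]].
  have /onthP[j jQ] : Q \in fintype.enum (U n) by rewrite mem_enum.
  exists (f^-1%FUN (n, j)) => //=; rewrite invK ?inE//.
  by rewrite /V /= jQ.
apply: (@le_trans _ _ (\sum_(0 <= i <oo) w (f i))%E).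
  apply: lee_nneseries => [i _ _|i _]; first exact: diameter_pow_ge0.
  exact: (Vw _).1.
rewrite -(esum_pred_image w _ xpredT) ?[fun=> _]set_true//.
rewrite image_eq.
have -> : \esum_(p in setT) w p =
    (\sum_(0 <= n <oo) \sum_(0 <= j <oo) w (n, j))%E.
  rewrite nneseries_esumT; last by move=> n; exact: nneseries_ge0.
  rewrite (@eq_esum _ _ _ _ (fun n => \esum_(j in setT) w (n, j))); last first.
    by move=> n _; rewrite nneseries_esumT.
  rewrite esum_esum//; congr (esum _ _).
    by apply/seteqP; split => // -[].
rewrite (_ : (\sum_(0 <= n <oo) _)%E = ((c `^ t)%:E * cost (scale_weight t) U)%E).
  have e_eta : c `^ t * e <= eta.
    by rewrite mulrC -ler_pdivlMr// ge_min lexx.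
  rewrite -lee_fin in e_eta; apply: le_trans e_eta; rewrite EFinM.
  by apply: lee_wpmul2l => //; rewrite lee_fin ltW.
rewrite /cost -nneseriesZl; last first.
  by move=> n _; rewrite lee_fin mulr_ge0// exprn_ge0// powR_ge0.
apply: eq_eseriesr => n _; rewrite /w /= nneseries_const -?EFinM ?mulrA//.
by rewrite mulr_ge0 ?exprn_ge0 ?powR_ge0.
Qed.

End Scales.

Lemma card_le_sum_cover (T I : finType) (S : {set T}) (W : I -> {set T}) :
  (forall x, x \in S -> exists i, x \in W i) -> (#|S| <= \sum_i #|W i|)%N.
Proof.
move=> SW; under eq_bigr do rewrite -sum1_card big_mkcond/=.
rewrite -sum1_card big_mkcond exchange_big; apply: leq_sum => x _.
by case: ifP => // /SW[i xi]; rewrite (bigD1 i)//= xi.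
Qed.

(** * Coverings by open balls and by the cubes near them *)

Section BallCovers.
Context {R : realType} {d M : nat} (hM : (1 < M)%N).
Implicit Types (t e q : R) (x : 'rV[R]_d) (A : set 'rV[R]_d).
Implicit Types (y : nat -> 'rV[R]_d) (k : nat -> nat).
Local Notation family := (forall n, {set cube_index d M n}).

Let M0 : (0 : R) < M%:R. Proof. by rewrite ltr0n ltnW. Qed.

Definition ball_union y k : set 'rV[R]_d :=
  \bigcup_i ball (y i) (2 * M%:R ^- k i).

(** Open balls are wanted for compactness. A covering set that meets [A] is enlarged to a ball
    around one of its points in [A], of radius comparable to its diameter. For diameter 0 the ball
    is taken so small that its weight is below an error term, which requires [t > 0]. *)
Lemma hausdorff_null_balls t0 t e A : 0 <= t0 -> t0 < t -> 0 < e ->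
  A `<=` unit_cube -> hausdorff_measure t0 A = 0%E ->
  exists y k, [/\ forall i, unit_cube (y i), A `<=` ball_union y k &
    (\sum_(0 <= i <oo) (scale_weight t (M := M) ^+ k i)%:E <= e%:E)%E].
Proof.
move=> t00 t0t e0 AI HA; have tgt0 := le_lt_trans t00 t0t.
pose c : R := M%:R `^ t.
have c0 : 0 < c by exact: powR_gt0.
(* The mesh [2^-1] makes the diameters at most 1, as [side_between] and the passage from [t0] to [t]
   require. Half of [e] pays for the diameters, the other half for the errors [ei]. *)
have : (hausdorff_premeasure t0 2^-1 A < (e / 2 / c)%:E)%E.
  apply: (@le_lt_trans _ _ (hausdorff_measure t0 A)).
    by apply: ereal_sup_ubound; exists 2^-1 => //=; rewrite invr_gt0.
  by rewrite HA lte_fin !divr_gt0.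
move=> /ereal_inf_lt[_ [U [AU Ud] <-] Ue].
pose ei i : R := e / 2 / (2 ^ i.+1)%:R.
have ei0 i : 0 < ei i by rewrite !divr_gt0// ltr0n expn_gt0.
have /choice[p pP] i : exists p : 'rV[R]_d * nat, [/\ unit_cube p.1,
    A `&` U i `<=` ball p.1 (2 * M%:R ^- p.2) &
    ((scale_weight t (M := M) ^+ p.2)%:E <=
     c%:E * diameter_pow t0 (U i) + (ei i)%:E)%E].
  have [Ai0|/set0P[x0 [Ax0 Ux0]]] := eqVneq (A `&` U i) set0.
    have [n ne] := scale_weight_lt hM tgt0 (ei0 i).
    exists (0, n); split => /=.
    - by move=> l; rewrite mxE lexx ler01.
    - by rewrite Ai0.
    - apply: (@le_trans _ _ (0 + (ei i)%:E)%E).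
        by rewrite add0e lee_fin ltW.
      rewrite leeD2r// mule_ge0 ?diameter_pow_ge0// lee_fin ltW//.
  have dist_le x : U i x -> ((eucl_dist x0 x)%:E <= diameter (U i))%E.
    move=> Ux; apply: ereal_sup_ubound; right.
    by exists x0 => //; exists x.
  have Un0 : U i == set0 = false.
    by apply/negbTE/set0P; exists x0.
  have := Ud i; have := diameter_ge0 (U i); move: dist_le.
  rewrite /diameter_pow Un0; case: (diameter (U i)) => [D| |] //.
  rewrite !lee_fin => dist_le D0 D2.
  have [DE|DN] := eqVneq D 0; last first.
    have Dgt0 : 0 < D by rewrite lt_def DN.
    have [n /andP[Dn nD]] : exists n, D <= (M%:R : R) ^- n <= M%:R * D.
      by apply: side_between => //; rewrite Dgt0/=; lra.
    have n0 : 0 < (M%:R : R) ^- n by rewrite invr_gt0 exprn_gt0.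
    exists (x0, n); split => /=; first exact: AI.
    - move=> x [Ax Ux]; apply/rV_ballP; split; first by rewrite mulr_gt0.
      move=> l; apply: (le_lt_trans (coord_le_eucl_dist _ _ _)).
      have := dist_le _ Ux; rewrite lee_fin; lra.
    - rewrite ?poweR_EFin -EFinM -EFinD lee_fin.
      apply: (@le_trans _ _ (c * D `^ t0)); last by rewrite lerDl ltW.
      rewrite scale_weightE//; apply: (@le_trans _ _ ((M%:R * D) `^ t)).
        apply: ge0_ler_powR => //; rewrite ?nnegrE; lra.
      rewrite powRM ?(ltW M0) ?(ltW Dgt0)// ler_wpM2l ?powR_ge0//.
      by apply: ger_powR; [rewrite Dgt0/=; lra|exact: ltW].
  have [n ne] := scale_weight_lt hM tgt0 (ei0 i).
  have n0 : 0 < (M%:R : R) ^- n by rewrite invr_gt0 exprn_gt0.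
  exists (x0, n); split => /=; first exact: AI.
  - move=> x [Ax Ux]; apply/rV_ballP; split; first by rewrite mulr_gt0.
    move=> l; apply: (le_lt_trans (coord_le_eucl_dist _ _ _)).
    have := dist_le _ Ux; rewrite lee_fin; lra.
  - rewrite ?poweR_EFin -EFinM -EFinD lee_fin.
    by rewrite (le_trans (ltW ne))// lerDr mulr_ge0 ?powR_ge0.
exists (fun i => (p i).1), (fun i => (p i).2); split.
- by move=> i; have [] := pP i.
- move=> x Ax; have [i _ Ux] := AU x Ax; exists i => //.
  by have [_ h _] := pP i; apply: h.
- apply: (@le_trans _ _ (\sum_(0 <= i <oo)
      (c%:E * diameter_pow t0 (U i) + (ei i)%:E))%E).
    apply: lee_nneseries => [i _ _|i _].
      by rewrite lee_fin exprn_ge0// powR_ge0.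
    by have [] := pP i.
  have cd0 i : (0 <= c%:E * diameter_pow t0 (U i))%E.
    by rewrite mule_ge0 ?diameter_pow_ge0// lee_fin ltW.
  apply: le_trans (epsilon_trick _ cd0 _) _; first by rewrite divr_ge0// ltW.
  rewrite nneseriesZl; last by move=> i _; exact: diameter_pow_ge0.
  apply: (@le_trans _ _ (c%:E * (e / 2 / c)%:E + (e / 2)%:E)%E).
    by rewrite leeD2r// lee_wpmul2l ?(ltW Ue)// lee_fin ltW.
  rewrite -EFinM -EFinD lee_fin mulrCA divff ?gt_eqF// mulr1.
  by rewrite -splitr.
Qed.

(** The margin 2 is enough for all the closed cubes that meet the ball of radius [2 * M ^ -n] about
    [y], and leaves five values for each coordinate. *)
Definition nearby n (y : 'rV[R]_d) : {set cube_index d M n} :=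
  [set Q : cube_index d M n | [forall l,
    (Q l <= address hM n y l + 2) && (address hM n y l <= Q l + 2)]]%N%SET.

Lemma card_nearby n (y : 'rV[R]_d) : (#|nearby n y| <= 5 ^ d)%N.
Proof.
pose f (Q : cube_index d M n) : {ffun 'I_d -> 'I_5} :=
  [ffun l => inord (Q l + 2 - address hM n y l)].
have /card_in_imset <- : {in nearby n y &, injective f}.
  move=> Q Q'; rewrite !inE => /forallP hQ /forallP hQ' /ffunP ff.
  apply/ffunP => l; apply: val_inj.
  have := congr1 val (ff l); have := hQ l; have := hQ' l.
  rewrite !ffunE/=; move: (interval_index _ _) => a.
  by move=> /andP[? ?] /andP[? ?]; rewrite !inordK; lia.
apply: leq_trans (max_card _) _.
by rewrite card_ffun !card_ord.
Qed.

Lemma ball_nearby n (y : 'rV[R]_d) x (Q : cube_index d M n) : unit_cube y ->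
  ball y (2 * M%:R ^- n) x -> cube Q x -> Q \in nearby n y.
Proof.
move=> yI /rV_ballP[_ xy] Qx; rewrite inE; apply/forallP => l.
have /andP[a1 a2] := cube_address hM n yI l.
have /andP[b1 b2] := Qx l.
have := xy l; rewrite ltr_norml => /andP[c1 c2].
move: (address _ _ _ _) a1 a2 => a a1 a2.
have n0 : 0 < (M%:R : R) ^- n by rewrite invr_gt0 exprn_gt0.
apply/andP; split; rewrite -ltnS -addnS -(ltr_nat R) natrD -(ltr_pM2r n0);
  rewrite -natr1 mulrDl mul1r in a2 b2; rewrite mulrDl -natr1 mulrDl mul1r; lra.
Qed.

Definition ball_family y k : family := fun n =>
  [set Q : cube_index d M n | `[< exists2 i, k i = n & Q \in nearby n (y i) >]]%SET.

Lemma cost_ball_family q y k : 0 <= q ->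
  (cost q (ball_family y k) <=
   (5 ^ d)%:R%:E * \sum_(0 <= i <oo) (q ^+ k i)%:E)%E.
Proof.
move=> q0; have q0' n : 0 <= q ^+ n by exact: exprn_ge0.
pose a n i : R := if n == k i then (5 ^ d)%:R * q ^+ k i else 0.
have a0 n i : (0 <= (a n i)%:E)%E.
  by rewrite lee_fin /a; case: ifP => // _; rewrite mulr_ge0.
apply: (@le_trans _ _ (\sum_(0 <= n <oo) \sum_(0 <= i <oo) (a n i)%:E)%E).
  apply: lee_nneseries => n _; first by rewrite lee_fin mulr_ge0.
  pose W : nat -> family := fun i m =>
    if m == k i then nearby m (y i) else finset.set0.
  (* Infinitely many balls may have level [n], but finitely many of them already give all the cubes
     of [ball_family] there. *)
  have [|m mP] := @family_eventually d M W (ball_family y k) n.+1.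
    move=> j Q; rewrite inE => /asboolP[i ij Qi]; exists i.
    by rewrite /W ifT ?ij.
  have cardB : (#|ball_family y k n| <= \sum_(i < m.+1) #|W i n|)%N.
    apply: card_le_sum_cover => Q /(mP _ _ (leqnn _))[i im QW].
    by exists (Ordinal (im : (i < m.+1)%N)).
  apply: (@le_trans _ _ (\sum_(0 <= i < m.+1) (a n i)%:E)%E); last first.
    by apply: nneseries_lim_ge => *; exact: a0.
  rewrite sumEFin lee_fin big_mkord.
  apply: (@le_trans _ _ (q ^+ n * (\sum_(i < m.+1) #|W i n|)%:R)).
    by rewrite ler_wpM2l// ler_nat.
  rewrite natr_sum mulr_sumr; apply: ler_sum => i _.
  rewrite /a /W; case: eqP => [<-|_]; last by rewrite cards0 mulr0.
  by rewrite mulrC ler_wpM2r// ler_nat card_nearby.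
rewrite nneseries_interchange//.
rewrite -nneseriesZl; last by move=> i _; rewrite lee_fin.
apply: lee_nneseries => [i _ _|i _]; first exact: nneseries_ge0.
by rewrite nneseries_single ?EFinM// mulr_ge0.
Qed.

(** A point on a face may survive through a cube other than its address; at the covering level, all
    the closed cubes containing it are therefore demanded. *)
Definition fat_cover (U : family) A := forall x, A x -> exists n,
  forall Q : cube_index d M n, cube Q x -> Q \in U n.

Lemma fat_cover_address U A : A `<=` unit_cube -> fat_cover U A ->
  address_cover hM U A.
Proof.
move=> AI UA x Ax; have [n h] := UA x Ax; exists n; apply: h.
exact/cube_address/AI.
Qed.

Lemma ball_family_cover y k i x : unit_cube (y i) ->
  ball (y i) (2 * M%:R ^- k i) x ->
  exists n, forall Q : cube_index d M n, cube Q x -> Q \in ball_family y k n.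
Proof.
move=> yI xi; exists (k i) => Q Qx; rewrite inE; apply/asboolP; exists i => //.
exact: ball_nearby xi Qx.
Qed.

Lemma hausdorff_null_fat_cover t0 t e A : 0 <= t0 -> t0 < t -> 0 < e ->
  A `<=` unit_cube -> hausdorff_measure t0 A = 0%E ->
  exists2 U, fat_cover U A & (cost (scale_weight t (M := M)) U <= e%:E)%E.
Proof.
move=> t00 t0t e0 AI HA.
have c0 : (0 : R) < (5 ^ d)%:R by rewrite ltr0n expn_gt0.
have [|y [k [yI Ayk ke]]] :=
  @hausdorff_null_balls t0 t (e / (5 ^ d)%:R) A t00 t0t _ AI HA.
  by rewrite divr_gt0.
exists (ball_family y k) => [x /Ayk[i _ xi]|].
  exact: ball_family_cover xi.
apply: le_trans (cost_ball_family _ _ (powR_ge0 _ _)) _.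
apply: (@le_trans _ _ ((5 ^ d)%:R%:E * (e / (5 ^ d)%:R)%:E)%E).
  by rewrite lee_wpmul2l.
by rewrite -EFinM lee_fin mulrC divfK// gt_eqF.
Qed.

(** By compactness, a cheap covering of a limit set becomes a finite covering of one of its
    approximations, which can be confronted with the mass on a finite level. *)
Lemma hausdorff_null_compact_cover t0 t e A (L : nat -> set 'rV[R]_d) :
  0 <= t0 -> t0 < t -> 0 < e -> hausdorff_measure t0 A = 0%E ->
  A `<=` unit_cube -> (forall n, closed (L n)) ->
  (forall n, L n.+1 `<=` L n) -> unit_cube `&` \bigcap_n L n `<=` A ->
  exists m U, [/\ forall n, (m <= n)%N -> U n = finset.set0,
    fat_cover U (unit_cube `&` L m) &
    (cost (scale_weight t (M := M)) U <= e%:E)%E].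
Proof.
move=> t00 t0t e0 HA AI Lc Ldec LA.
have c0 : (0 : R) < (5 ^ d)%:R by rewrite ltr0n expn_gt0.
have [|y [k [yI Ayk ke]]] :=
  @hausdorff_null_balls t0 t (e / (5 ^ d)%:R) A t00 t0t _ AI HA.
  by rewrite divr_gt0.
have oB i : open (ball (y i) (2 * M%:R ^- k i)) by exact: ball_open.
have [||n nV] := @compact_decreasing 'rV[R]_d unit_cube (ball_union y k) L
  unit_cube_compact _ Lc Ldec.
- by apply: bigcup_open => i _.
- exact: subset_trans LA Ayk.
have Lle i j : (i <= j)%N -> L j `<=` L i.
  move=> /subnK <-; elim: (j - i)%N => [//|l IH] x; rewrite addSn => /Ldec.
  exact: IH.
have unit_closed : closed (unit_cube : set 'rV[R]_d).
  by apply: compact_closed unit_cube_compact; exact: norm_hausdorff.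
have : compact (unit_cube `&` L n).
  apply: subclosed_compact unit_cube_compact (@subIsetl _ _ _).
  exact: closedI.
rewrite compact_cover => /(_ nat setT _ (fun i _ => oB i) nV)[D _ DL].
pose m := maxn n (\max_(i <- finmap.enum_fset D) (k i).+1)%N.
exists m, (fun l => if (l < m)%N then ball_family y k l else finset.set0); split.
- by move=> l; rewrite ltnNge => ->.
- move=> x [xI Lx].
  have [i /= iD xi] := DL x (conj xI (Lle _ _ (leq_maxl _ _) _ Lx)).
  exists (k i) => Q Qx; rewrite ifT; last first.
    rewrite /m leq_max; apply/orP; right.
    exact: (leq_bigmax_seq (F := fun i => (k i).+1)).
  rewrite inE; apply/asboolP; exists i => //.
  exact: ball_nearby xi Qx.
apply: (@le_trans _ _ (cost (scale_weight t (M := M)) (ball_family y k))).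
  apply: le_cost => [|l]; first exact: powR_ge0.
  by case: ifP => // _; rewrite cards0.
apply: le_trans (cost_ball_family _ _ (powR_ge0 _ _)) _.
apply: (@le_trans _ _ ((5 ^ d)%:R%:E * (e / (5 ^ d)%:R)%:E)%E).
  by rewrite lee_wpmul2l.
by rewrite -EFinM lee_fin mulrC divfK// gt_eqF.
Qed.

End BallCovers.

(** * Mass distributions on finite levels *)

Section PositiveContent.
Context {R : realType} {d M : nat} (hM : (1 < M)%N).
Implicit Types (t : R) (A F K : set 'rV[R]_d).

Lemma content_gt0 t A : 0 < t -> A `<=` unit_cube ->
  hausdorff_measure t A <> 0%E ->
  exists2 c : R, 0 < c & (c%:E < content hM (scale_weight t (M := M)) A)%E.
Proof.
move=> t0 AI HA; have q0 : 0 <= scale_weight t (R := R) (M := M) by exact: powR_ge0.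
have := content_fin_num hM A q0; have := content_ge0 hM A q0.
case E : (content _ _ _) => [a| |] // a0 _; rewrite lee_fin in a0.
have [a00|an0] := eqVneq a 0; last first.
  have agt0 : 0 < a by rewrite lt_def an0.
  by exists (a / 2); rewrite ?lte_fin; lra.
exfalso; apply: HA; apply: (hausdorff_null_of_cubes hM t0) => e e0.
have : (content hM (scale_weight t (M := M)) A < e%:E)%E.
  by rewrite E a00 lte_fin.
move=> /ereal_inf_lt[_ [U UA <-] /ltW Ue]; exists U => // x Ax.
have [n xn] := UA x Ax; exists n, (address hM n x); split => //.
by apply: cube_address; exact: AI.
Qed.

(** If the compact set given by capacitability for [t1] were null for [t < t1], open balls of small
    [t1]-cost would cover it, and their union would be a neighbourhood of too small a content. *)
Lemma borel_compact_content F t t1 : 0 < t -> t < t1 -> borel_set F ->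
  F `<=` unit_cube -> hausdorff_measure t1 F <> 0%E ->
  exists K, exists c : R, [/\ closed K, K `<=` F, 0 < c &
    (c%:E < content hM (scale_weight t (M := M)) K)%E].
Proof.
move=> t0 tt1 bF FI HF; have t10 := lt_trans t0 tt1.
have [c1 c10 c1F] := content_gt0 t10 FI HF.
have [K [Kc KF KV]] := content_capacitable (powR_ge0 _ _) FI (borel_suslin bF) c1F.
have KI := subset_trans KF FI.
suff HK : hausdorff_measure t K <> 0%E.
  by have [c c0 cK] := content_gt0 t0 KI HK; exists K, c.
move=> HK.
have m0 : (0 : R) < (5 ^ d)%:R by rewrite ltr0n expn_gt0.
have [|y [k [yI Kyk ke]]] :=
  @hausdorff_null_balls _ _ _ hM t t1 (c1 / (5 ^ d)%:R) K (ltW t0) tt1 _ KI HK.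
  by rewrite divr_gt0.
have oV : open (ball_union (M := M) y k).
  by apply: bigcup_open => i _; exact: ball_open.
have := KV _ oV Kyk; apply/negP; rewrite -leNgt.
apply: (@le_trans _ _ (cost (scale_weight t1 (M := M)) (ball_family hM y k))).
  apply: content_le; apply: fat_cover_address => [x []//|x [[i _ xi] xI]].
  exact: ball_family_cover xi.
apply: le_trans (cost_ball_family _ _ _ (powR_ge0 _ _)) _.
apply: (@le_trans _ _ ((5 ^ d)%:R%:E * (c1 / (5 ^ d)%:R)%:E)%E).
  by rewrite lee_wpmul2l.
by rewrite -EFinM lee_fin mulrC divfK// gt_eqF.
Qed.

End PositiveContent.

Section FiniteFrostman.
Context {R : realType} {d M : nat} (hM : (1 < M)%N).
Implicit Types (q c : R) (K : set 'rV[R]_d) (n k : nat).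
Local Notation family := (forall n, {set cube_index d M n}).

Definition node_mass n (m : cube_index d M n -> R) k (Q : cube_index d M k) : R :=
  \sum_(Q' | ancestor hM k Q' == Q) m Q'.

(* The leaves are treated one after the other; the mass of each is increased
   until one of the cubes containing it is saturated. *)
Lemma saturating_mass q n (s : seq (cube_index d M n)) : 0 <= q ->
  exists m : cube_index d M n -> R, [/\ forall Q, 0 <= m Q,
    forall Q, Q \notin s -> m Q = 0,
    forall k (Q : cube_index d M k), (k <= n)%N -> node_mass m Q <= q ^+ k &
    forall Q, Q \in s -> exists2 k, (k <= n)%N &
      node_mass m (ancestor hM k Q) = q ^+ k].
Proof.
move=> q0; elim: s => [|Q0 s [m [m0 ms mq msat]]].
  exists (fun=> 0); split => // k Q kn.
  by rewrite /node_mass big1// exprn_ge0.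
pose slack (k : 'I_n.+1) : R := q ^+ k - node_mass m (ancestor hM k Q0).
have [k0 _ k0min] := arg_minP slack (erefl : xpredT (@ord0 n)).
set a := slack k0 in k0min.
have a0 : 0 <= a by rewrite subr_ge0 mq// -ltnS.
exists (fun Q => m Q + (if Q == Q0 then a else 0)).
have massE k (Q : cube_index d M k) :
    node_mass (fun Q => m Q + (if Q == Q0 then a else 0)) Q =
    node_mass m Q + (if ancestor hM k Q0 == Q then a else 0).
  rewrite /node_mass big_split/=; congr (_ + _).
  rewrite -big_mkcondr/=; case: ifPn => h.
    by rewrite (big_pred1 Q0)// => Q' /=; rewrite andb_idl// => /eqP ->.
  rewrite big_pred0// => Q'; apply/negP => /andP[hQ /eqP QE].
  by rewrite -QE hQ in h.
have bnd k (Q : cube_index d M k) : (k <= n)%N ->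
    node_mass m Q + (if ancestor hM k Q0 == Q then a else 0) <= q ^+ k.
  move=> kn; case: eqP => [<-|_]; last by rewrite addr0 mq.
  have := k0min (Ordinal (kn : (k < n.+1)%N)) isT.
  by rewrite /slack/= lerBrDl.
split.
- by move=> Q; rewrite addr_ge0//; case: ifP.
- move=> Q; rewrite inE negb_or => /andP[/negbTE -> /ms ->].
  by rewrite addr0.
- by move=> k Q kn; rewrite massE bnd.
- move=> Q; rewrite inE => /predU1P[->|/msat[k kn Qk]].
    exists k0; first by rewrite -ltnS.
    by rewrite massE eqxx /a /slack addrC subrK.
  exists k => //; apply/eqP; rewrite eq_le massE bnd//= Qk lerDl.
  by case: ifP.
Qed.

(** The saturated cubes cover [K]. Their maximal ones are disjoint and carry masses equal to their
    weights, so the total mass is at least the cost of a covering. *)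
Lemma finite_frostman q c n K : 0 <= q -> K `<=` unit_cube ->
  (c%:E <= content hM q K)%E ->
  exists m : cube_index d M n -> R, [/\ forall Q, 0 <= m Q,
    forall Q, m Q != 0 -> exists2 x, K x & address hM n x = Q,
    forall k (Q : cube_index d M k), (k <= n)%N -> node_mass m Q <= q ^+ k &
    c <= \sum_Q m Q].
Proof.
move=> q0 KI cK.
pose s := [seq Q <- index_enum (cube_index d M n) |
  `[< exists2 x, K x & address hM n x = Q >]].
have sP Q : Q \in s <-> exists2 x, K x & address hM n x = Q.
  by rewrite mem_filter mem_index_enum andbT; split => /asboolP.
have [m [m0 ms mq msat]] := saturating_mass s q0.
exists m; split => // [Q mQ|].
  by apply/sP; apply: contraNT mQ => /ms ->.
pose Sat : family := fun k =>
  [set Q : cube_index d M k | (k <= n)%N && (node_mass m Q == q ^+ k)]%SET.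
have Satc : address_cover hM Sat K.
  move=> x Kx; have /msat[k kn xk] : address hM n x \in s by apply/sP; exists x.
  exists k; rewrite inE kn -xk address_ancestor ?eqxx//.
  exact: KI.
have topsc := tops_cover KI Satc.
rewrite -lee_fin (le_trans cK)// (le_trans (content_le q topsc))//.
rewrite (@cost_finite _ _ _ _ _ n.+1)//; last first.
  by move=> k nk; apply/setP => Q; rewrite !inE leqNgt nk.
rewrite lee_fin.
rewrite (eq_bigr (fun k : 'I_n.+1 => \sum_Q if ancestor hM k Q \in tops hM Sat k
    then m Q else 0)); last first.
  move=> k _; rewrite -big_mkcond/=.
  rewrite (partition_big (fun Q => ancestor hM k Q)
    (fun Q => Q \in tops hM Sat k))//=.
  rewrite mulr_natr -sumr_const; apply: eq_bigr => Q Qk.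
  have : Q \in Sat k by move: Qk; rewrite inE => /andP[].
  rewrite inE => /andP[_ /eqP <-]; apply: eq_bigl => Q'.
  by case: eqP => [->|]; rewrite ?Qk ?andbF.
rewrite exchange_big/=; apply: ler_sum => Q _.
have [[k /= Qk]|nk] := pselect (exists k : 'I_n.+1, ancestor hM k Q \in tops hM Sat k).
  rewrite (bigD1 k)//= Qk big1 ?addr0// => j jk; case: ifP => // Qj.
  have anti (i l : 'I_n.+1) : (i < l)%N -> ancestor hM i Q \in tops hM Sat i ->
      ancestor hM l Q \in tops hM Sat l -> False.
    move=> il; rewrite inE => /andP[iS _].
    rewrite inE => /andP[_ /forallP/(_ (Ordinal il))/=].
    by rewrite ancestor_trans ?iS// ltnW//= -ltnS.
  exfalso; move: jk; rewrite -val_eqE /= neq_ltn => /orP[] h.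
    exact: anti h Qj Qk.
  exact: anti h Qk Qj.
by rewrite big1// => k _; case: ifP => // Qk; exfalso; apply: nk; exists k.
Qed.

End FiniteFrostman.

(** * Probabilities of surviving cubes *)

Lemma card_draws_containing (T : finType) (A B : {set T}) (n : nat) :
  A \subset B -> (#|A| <= n)%N ->
  #|[set S : {set T} | [&& A \subset S, S \subset B & #|S| == n]]%SET| =
  'C(#|B| - #|A|, n - #|A|).
Proof.
move=> AB An; rewrite -cardsDS// -cards_draws.
rewrite -(card_in_imset (f := fun S => (S :\: A)%SET)); last first.
  move=> S S'; rewrite !inE => /and3P[AS _ _] /and3P[AS' _ _] /setP SS.
  apply/setP => x; have := SS x; rewrite !inE.
  have [xA|//] := boolP (x \in A).
  by rewrite (fintype.subsetP AS)// (fintype.subsetP AS').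
apply: eq_card => S; rewrite !inE; apply/imsetP/andP.
  move=> [S']; rewrite inE => /and3P[AS' SB /eqP Sn] ->.
  by rewrite finset.setSD// cardsDS// Sn.
rewrite subsetD => -[/andP[SB SA] /eqP Sn].
have ASU : #|(S :|: A)%SET| = n.
  rewrite cardsU (disjoint_setI0 SA) cards0 subn0 Sn subnK//.
exists (S :|: A)%SET.
  by rewrite inE finset.subsetUr finset.subUset SB AB ASU eqxx.
by rewrite finset.setDUl finset.setDv finset.setU0; apply/esym/finset.setDidPl.
Qed.

Lemma bin_ratio1 {R : realFieldType} (m n : nat) : (0 < n <= m)%N ->
  ('C(m - 1, n - 1))%:R / ('C(m, n))%:R = n%:R / m%:R :> R.
Proof.
case: m => [|m]; case: n => [|n] //=.
rewrite ltnS => nm; rewrite !subn1/=.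
have C0 : (0 < 'C(m.+1, n.+1))%N by rewrite bin_gt0 ltnS.
apply/eqP; rewrite eqr_div ?pnatr_eq0 -?lt0n//.
by rewrite -!natrM mulnC mul_bin_diag.
Qed.

(** The ratio is [n / m] times [(n - 1) / (m - 1)], and the latter is at most [n / m]: inclusions in
    a draw without replacement are negatively correlated. *)
Lemma bin_ratio2 {R : realFieldType} (m n : nat) : (1 < n <= m)%N ->
  ('C(m - 2, n - 2))%:R / ('C(m, n))%:R <= (n%:R / m%:R) ^+ 2 :> R.
Proof.
move=> /andP[n1 nm].
have C1 : (0 < 'C(m - 1, n - 1))%N by rewrite bin_gt0 leq_sub2r.
have -> : ('C(m - 2, n - 2))%:R / ('C(m, n))%:R =
    ('C(m - 2, n - 2))%:R / ('C(m - 1, n - 1))%:R *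
    (('C(m - 1, n - 1))%:R / ('C(m, n))%:R) :> R.
  by rewrite mulrA divfK// pnatr_eq0 -lt0n.
rewrite bin_ratio1; last by rewrite (ltn_trans _ n1).
have -> : (m - 2 = m - 1 - 1)%N by rewrite -subnDA.
have -> : (n - 2 = n - 1 - 1)%N by rewrite -subnDA.
rewrite bin_ratio1; last by rewrite subn_gt0 n1 leq_sub2r.
rewrite expr2 ler_wpM2r ?divr_ge0//.
rewrite ler_pdivrMr; last by rewrite ltr0n subn_gt0 (leq_trans n1).
rewrite mulrAC ler_pdivlMr; last by rewrite ltr0n (leq_trans _ nm)// ltnW.
rewrite -!natrM ler_nat mulnBl mulnBr mul1n muln1; lia.
Qed.

Section TotalProbability.
Context {R : realType} {disp : measure_display} {T : measurableType disp}.
Context (P : probability T R).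
Implicit Types (E : set T).

Definition prob E : R := fine (P E).

Lemma probE E : measurable E -> P E = (prob E)%:E.
Proof. by move=> mE; rewrite fineK// fin_num_measure. Qed.

Lemma prob_ge0 E : 0 <= prob E.
Proof. by rewrite fine_ge0. Qed.

Lemma prob0 : prob set0 = 0.
Proof. by rewrite /prob measure0. Qed.

Lemma le_prob E E' : measurable E -> measurable E' -> E `<=` E' ->
  prob E <= prob E'.
Proof. by move=> mE mE' EE'; rewrite -lee_fin -!probE// le_measure ?inE. Qed.

Lemma total_probability (I : finType) (Z : T -> I) E : measurable E ->
  (forall i, measurable [set w | Z w = i]) ->
  prob E = \sum_i prob (E `&` [set w | Z w = i]).
Proof.
move=> mE mZ.
suff h (s : seq I) : uniq s -> measurable (E `&` [set w | Z w \in s]) /\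
    prob (E `&` [set w | Z w \in s]) = \sum_(i <- s) prob (E `&` [set w | Z w = i]).
  have [_ <-] := h _ (index_enum_uniq I); congr prob.
  by apply/seteqP; split => [w Ew|w []//]; split => //=; rewrite mem_index_enum.
elim: s => [_|i s IH /= /andP[ni us]].
  rewrite (_ : _ `&` _ = set0) ?big_nil ?prob0//.
  by apply/seteqP; split => // w [].
have [ms Es] := IH us.
have mi : measurable (E `&` [set w | Z w = i]) by exact: measurableI.
have -> : E `&` [set w | Z w \in i :: s] =
    (E `&` [set w | Z w = i]) `|` (E `&` [set w | Z w \in s]).
  rewrite -setIUr; congr (_ `&` _); apply/seteqP; split => w /=; rewrite inE.
    by move=> /predU1P.
  by move=> h; apply/predU1P.
split; first exact: measurableU.
rewrite big_cons -Es -[RHS]/(fine (_ + _)%:E) EFinD -!probE// /prob measureU//.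
by apply/seteqP; split => // w [[_ /= wi] [_ /= ws]]; rewrite -wi ws in ni.
Qed.

End TotalProbability.

Section RandomCubes.
Context {R : realType} {disp : measure_display} {T : measurableType disp}.
Context {P : probability T R} {d M N : nat} (hM : (1 < M)%N).
Context (hN : (1 <= N <= M ^ d)%N).
Context {C : forall n : nat, T -> {set cube_index d M n}}.
Context (hC : random_cantor P N C).
Implicit Types (n k : nat).

Definition retention : R := N%:R / (M ^ d)%:R.
Local Notation p := retention.
Local Notation pr := (prob P).

Lemma retention_gt0 : 0 < p.
Proof. by have /andP[? ?] := hN; rewrite divr_gt0// ltr0n// expM_gt0. Qed.

Lemma retention_le1 : p <= 1.
Proof.
have /andP[? ?] := hN.
by rewrite ler_pdivrMr ?ltr0n ?expM_gt0// mul1r ler_nat.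
Qed.

Lemma card_subcubes n (Q : cube_index d M n) : #|subcubes Q| = (M ^ d)%N.
Proof.
have ltf (f : {ffun 'I_d -> 'I_M}) l : (M * Q l + f l < M ^ n.+1)%N.
  by rewrite expnS; have := ltn_ord (f l); have := ltn_ord (Q l); nia.
pose g (f : {ffun 'I_d -> 'I_M}) : cube_index d M n.+1 :=
  [ffun l => Ordinal (ltf f l)].
have M0 : (0 < M)%N by exact: ltnW.
have ginj : injective g.
  move=> f f' /ffunP ff; apply/ffunP => l; apply: val_inj.
  by have := congr1 val (ff l); rewrite !ffunE/= => /addnI.
have -> : (M ^ d = #|{: {ffun 'I_d -> 'I_M}}|)%N by rewrite card_ffun !card_ord.
rewrite -(card_imset _ ginj); apply: eq_card => Q'.
rewrite inE; apply/forallP/imsetP => [h|[f _ ->] l].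
  exists [ffun l => Ordinal (ltn_pmod (Q' l) M0)] => //.
  apply/ffunP => l; apply: val_inj; rewrite !ffunE /= -(eqP (h l)).
  by rewrite ffunE /= {1}(divn_eq (Q' l) M) mulnC.
by rewrite ffunE /= mulnC divnMDl// divn_small ?addn0.
Qed.

Lemma measurable_level n (B : {set cube_index d M n} -> Prop) :
  measurable [set w | B (C n w)].
Proof.
rewrite (_ : [set w | _] = \bigcup_(A in [set A | B A]) [set w | C n w = A]).
  apply: fin_bigcup_measurable => [|A _]; first exact: finite_finset.
  exact: (random_cantor_measurable hC).
apply/seteqP; split => w /=; first by move=> Bw; exists (C n w).
by move=> [A BA /= wA]; rewrite wA.
Qed.

Definition level_law n (A : {set cube_index d M n}) : R := pr (chosen_at C A).

Lemma level_law_ge0 n (A : {set cube_index d M n}) : 0 <= level_law A.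
Proof. exact: prob_ge0. Qed.

Lemma prob_level n (B : pred {set cube_index d M n}) :
  pr [set w | B (C n w)] = \sum_(A | B A) level_law A.
Proof.
rewrite (@total_probability _ _ _ P _ (C n)); [|exact: (measurable_level (fun A => B A))|].
  rewrite [RHS]big_mkcond/=; apply: eq_bigr => A _.
  case: ifPn => BA; last first.
    rewrite -(prob0 P); congr prob; apply/seteqP; split => // w [/= Bw wA].
    by rewrite -wA Bw in BA.
  by congr prob; apply/seteqP; split => w /=; [case|move=> wA; rewrite wA].
by move=> A; exact: (random_cantor_measurable hC).
Qed.

Lemma sum_level_law n : \sum_A level_law (n := n) A = 1.
Proof.
rewrite -(prob_level xpredT) /prob (_ : [set w | _] = setT) ?probability_setT//.
by apply/seteqP; split.
Qed.

Lemma measurable_chosen_in n (Q : cube_index d M n) S :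
  measurable (chosen_in C Q S).
Proof. exact: (measurable_level (fun A => (A :&: subcubes Q)%SET = S)). Qed.

(** The joint form of the uniformity holds also when [A] has probability 0, so that it can be summed
    over all [A]. *)
Lemma prob_chosen_in n (A : {set cube_index d M n}) Q S : Q \in A ->
  pr (chosen_in C Q S `&` chosen_at C A) =
  if (S \subset subcubes Q) && (#|S| == N) then level_law A / ('C(M ^ d, N))%:R
  else 0.
Proof.
move=> QA; case: ifPn => [/andP[SQ /eqP SN]|nS]; last first.
  rewrite -(prob0 P); congr prob; apply/seteqP; split => // w [/= wS wA].
  move: nS; rewrite -wS finset.subsetIr (random_cantor_card hC)//.
    by rewrite eqxx.
  by rewrite wA.
have [A0|An0] := eqVneq (level_law A) 0.
  rewrite A0 mul0r; apply/eqP; rewrite eq_le prob_ge0 andbT -A0.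
  apply: le_prob; [|exact: (random_cantor_measurable hC)|exact: subIsetr].
  by apply: measurableI; [exact: measurable_chosen_in|exact: (random_cantor_measurable hC)].
have Agt0 : (0 < P (chosen_at C A))%E.
  rewrite probE; last exact: (random_cantor_measurable hC).
  by rewrite lte_fin lt_def An0 level_law_ge0.
have := random_cantor_uniform hC Agt0 QA SQ SN.
by move=> /(canRL (divfK An0)) h; rewrite /prob h mulrC.
Qed.

Lemma prob_subset_children n (A : {set cube_index d M n}) Q
    (B : {set cube_index d M n.+1}) : Q \in A -> B \subset subcubes Q ->
  (#|B| <= N)%N ->
  pr ([set w | B \subset C n.+1 w] `&` chosen_at C A) = level_law A *
    (('C(M ^ d - #|B|, N - #|B|))%:R / ('C(M ^ d, N))%:R).
Proof.
move=> QA BQ BN.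
rewrite (@total_probability _ _ _ P _ (fun w => (C n.+1 w :&: subcubes Q)%SET));
  [|apply: measurableI; [exact: (measurable_level (fun A => B \subset A))|
     exact: (random_cantor_measurable hC)]|by move=> S; exact: measurable_chosen_in].
rewrite (eq_bigr (fun S : {set cube_index d M n.+1} =>
  if [&& B \subset S, S \subset subcubes Q & #|S| == N]
  then level_law A / ('C(M ^ d, N))%:R else 0)); last first.
  move=> S _; case: (boolP (B \subset S)) => BS /=.
    rewrite -prob_chosen_in//; congr prob; apply/seteqP; split => w /=.
      by move=> [[_ wA] wS].
    move=> [wS wA]; split => //; split => //.
    by apply: fintype.subset_trans BS _; rewrite -wS finset.subsetIl.
  rewrite -(prob0 P); congr prob; apply/seteqP; split => // w [[/= wB _] wS].
  by move: BS; rewrite -wS finset.subsetI wB BQ.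
rewrite -big_mkcond/= sumr_const -cardsE card_draws_containing// card_subcubes.
by rewrite -[LHS]mulr_natr mulrAC mulrA.
Qed.

Lemma prob_child n (A : {set cube_index d M n}) (Q : cube_index d M n.+1) :
  ancestor hM n Q \in A ->
  pr ([set w | Q \in C n.+1 w] `&` chosen_at C A) = level_law A * p.
Proof.
move=> QA; have /andP[N0 NM] := hN.
have := @prob_subset_children n A (ancestor hM n Q) [set Q]%SET QA.
rewrite cards1 finset.sub1set (subcubesE hM) eqxx => /(_ isT N0).
rewrite bin_ratio1// => <-; congr prob; apply/seteqP.
by split => w [/= wQ wA]; split => //=; move: wQ; rewrite finset.sub1set.
Qed.

Lemma sum_prob_chosen_in n (A : {set cube_index d M n})
    (Q : cube_index d M n.+1) : ancestor hM n Q \in A ->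
  \sum_(S : {set cube_index d M n.+1} | Q \in S)
    pr (chosen_in C (ancestor hM n Q) S `&` chosen_at C A) =
  level_law A * p.
Proof.
move=> QA; rewrite -(prob_child QA); set R0 := ancestor hM n Q.
rewrite (@total_probability _ _ _ P _ (fun w => (C n.+1 w :&: subcubes R0)%SET));
  [|apply: measurableI; [exact: (measurable_level (fun A => Q \in A))|
     exact: (random_cantor_measurable hC)]|by move=> S; exact: measurable_chosen_in].
have QR0 : Q \in subcubes R0 by rewrite (subcubesE hM).
rewrite big_mkcond/=; apply: eq_bigr => S _; case: ifPn => QS; last first.
  rewrite -(prob0 P); congr prob; apply/seteqP; split => // w [[/= wQ _] wS].
  by move: QS; rewrite -wS inE wQ QR0.
congr prob; apply/seteqP; split => w /=; last by move=> [[_ wA] wS].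
move=> [wS wA]; split => //; split => //.
by move: QS; rewrite -wS inE => /andP[].
Qed.

(** Children of the same cube are negatively correlated by [bin_ratio2], and cannot both survive if
    [N = 1]; children of different cubes are conditionally independent. *)
Lemma prob_children n (A : {set cube_index d M n})
    (Q Q' : cube_index d M n.+1) : Q != Q' ->
  ancestor hM n Q \in A -> ancestor hM n Q' \in A ->
  pr ([set w | (Q \in C n.+1 w) && (Q' \in C n.+1 w)] `&` chosen_at C A) <=
  level_law A * p ^+ 2.
Proof.
move=> QQ' QA Q'A; have /andP[N0 NM] := hN.
have [QE|QN] := eqVneq (ancestor hM n Q) (ancestor hM n Q').
  have [N1|N1] := leqP N 1.
    rewrite (_ : _ `&` _ = set0).
      by rewrite prob0 mulr_ge0 ?level_law_ge0// exprn_ge0// ltW// retention_gt0.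
    apply/seteqP; split => // w [/= /andP[wQ wQ'] wA].
    have QC : ancestor hM n Q \in C n w by rewrite wA.
    have := random_cantor_card hC QC; move: N1 => /[swap] <-.
    apply/negP; rewrite -ltnNge.
    apply: (@leq_trans #|[set Q; Q']%SET|); first by rewrite cards2 QQ'.
    apply: subset_leq_card; apply/fintype.subsetP => S.
    move=> /finset.set2P[] ->; rewrite finset.in_setI (subcubesE hM) ?wQ ?wQ'.
      by rewrite eqxx.
    by rewrite QE eqxx.
  have := @prob_subset_children n A (ancestor hM n Q) [set Q; Q']%SET QA.
  have -> : [set Q; Q']%SET \subset subcubes (ancestor hM n Q).
    by rewrite finset.subUset !finset.sub1set !(subcubesE hM) QE eqxx.
  rewrite cards2 QQ' => /(_ isT N1) h.
  rewrite (_ : [set w | _] = [set w | [set Q; Q']%SET \subset C n.+1 w]).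
    rewrite h ler_wpM2l ?level_law_ge0// bin_ratio2// N1//.
  by apply/seteqP; split => w /=; rewrite finset.subUset !finset.sub1set.
have [A0|An0] := eqVneq (level_law A) 0.
  rewrite A0 mul0r -A0; apply: le_prob; last exact: subIsetr.
    apply: measurableI; last exact: (random_cantor_measurable hC).
    exact: (measurable_level (fun A => (Q \in A) && (Q' \in A))).
  exact: (random_cantor_measurable hC).
have Agt0 : (0 < P (chosen_at C A))%E.
  rewrite probE; last exact: (random_cantor_measurable hC).
  by rewrite lte_fin lt_def An0 level_law_ge0.
set R1 := ancestor hM n Q in QA QN *; set R2 := ancestor hM n Q' in Q'A QN *.
pose cnd (R0 : cube_index d M n) S : R :=
  pr (chosen_in C R0 S `&` chosen_at C A) / level_law A.
have cndp (Q0 : cube_index d M n.+1) : ancestor hM n Q0 \in A ->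
    \sum_(S : {set cube_index d M n.+1} | Q0 \in S) cnd (ancestor hM n Q0) S = p.
  by move=> Q0A; rewrite -mulr_suml sum_prob_chosen_in// mulrC mulKf.
have cnd2 S S' : pr (chosen_in C R1 S `&` chosen_in C R2 S' `&` chosen_at C A) =
    level_law A * (cnd R1 S * cnd R2 S').
  pose f Q0 := if Q0 == R1 then S else S'.
  have JA : [set R1; R2]%SET \subset A.
    by rewrite finset.subUset !finset.sub1set QA Q'A.
  have := random_cantor_indep hC f Agt0 JA.
  rewrite big_setU1 ?inE//= big_set1 /f eqxx eq_sym (negbTE QN).
  rewrite (_ : \bigcap_(Q0 in _) _ = chosen_in C R1 S `&` chosen_in C R2 S').
    by move=> /(canRL (divfK An0)); rewrite mulrC.
  apply/seteqP; split => w.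
    move=> h; split.
      by have := h R1; rewrite eqxx; apply; rewrite /= !inE eqxx.
    by have := h R2; rewrite eq_sym (negbTE QN); apply; rewrite /= !inE eqxx orbT.
  move=> [w1 w2] Q0 /=; rewrite !inE => /orP[/eqP ->|/eqP ->]; rewrite ?eqxx//.
  by rewrite eq_sym (negbTE QN).
rewrite (@total_probability _ _ _ P _
  (fun w => ((C n.+1 w :&: subcubes R1)%SET, (C n.+1 w :&: subcubes R2)%SET)));
  first last.
- move=> [S S'].
  rewrite (_ : [set w | _] = chosen_in C R1 S `&` chosen_in C R2 S').
    by apply: measurableI; exact: measurable_chosen_in.
  by apply/seteqP; split => w /=; [case=> <- <-|case=> <- <-].
- apply: measurableI; last exact: (random_cantor_measurable hC).
  exact: (measurable_level (fun A => (Q \in A) && (Q' \in A))).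
rewrite (eq_bigr (fun SS : {set cube_index d M n.+1} *
      {set cube_index d M n.+1} => if (Q \in SS.1) && (Q' \in SS.2)
    then level_law A * (cnd R1 SS.1 * cnd R2 SS.2) else 0)); last first.
  have QR1 : Q \in subcubes R1 by rewrite (subcubesE hM).
  have QR2 : Q' \in subcubes R2 by rewrite (subcubesE hM).
  move=> [S S'] _ /=; case: ifPn => QS; last first.
    rewrite -(prob0 P); congr prob; apply/seteqP; split => // w.
    move=> [[/= /andP[wQ wQ'] _] [wS wS']].
    by move: QS; rewrite -wS -wS' !finset.in_setI wQ QR1 wQ' QR2.
  rewrite -cnd2; congr prob; apply/seteqP; split => w.
    by move=> [[_ wA] /= [wS wS']].
  move=> [[/= wS wS'] wA]; split; last by rewrite /= wS wS'.
  split => //=; move/andP: QS; rewrite -wS -wS' !finset.in_setI.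
  by move=> [/andP[-> _] /andP[-> _]].
rewrite -big_mkcond -mulr_sumr /=.
rewrite -(pair_big (fun S : {set cube_index d M n.+1} => Q \in S)
  (fun S' : {set cube_index d M n.+1} => Q' \in S')
  (fun S S' => cnd R1 S * cnd R2 S'))/=.
by rewrite -big_distrlr/= !cndp// expr2.
Qed.


End RandomCubes.

Section SecondMoment.
Context {R : realType} {disp : measure_display} {T : measurableType disp}.
Context {P : probability T R} {d M N : nat} (hM : (1 < M)%N).
Context (hN : (1 <= N <= M ^ d)%N).
Context {C : forall n : nat, T -> {set cube_index d M n}}.
Context (hC : random_cantor P N C).
Implicit Types (n k : nat).

Local Notation p := (@retention R d M N).
Local Notation law := (level_law (P := P) (C := C)).

Let p0 : 0 < p. Proof. exact: retention_gt0. Qed.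
Let p1 : p <= 1. Proof. exact: retention_le1. Qed.

Lemma sum_law_mem n (Q : cube_index d M n) :
  \sum_(A : {set cube_index d M n} | Q \in A) law A = p ^+ n.
Proof.
elim: n Q => [|n IH] Q.
  rewrite expr0 -(sum_level_law hC 0) -!(prob_level hC).
  congr prob; apply/seteqP; split => w //= _.
  by rewrite (random_cantor_init hC) inE.
rewrite -(prob_level hC (fun A => Q \in A)).
rewrite (@total_probability _ _ _ P _ (C n)); first last.
- by move=> A; exact: (random_cantor_measurable hC).
- exact: (measurable_level hC (fun A => Q \in A)).
rewrite exprSr -(IH (ancestor hM n Q)) mulr_suml [RHS]big_mkcond.
apply: eq_bigr => A _; case: ifPn => QA; first by rewrite (prob_child hN hC).
rewrite -(prob0 P); congr prob; apply/seteqP; split => // w [/= wQ wA].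
have [Q1] := random_cantor_nested hC wQ.
by rewrite (subcubesE hM) wA => Q1A /eqP QE; rewrite QE Q1A in QA.
Qed.

(** If the branches separate after level [j], the joint probability is at most [p ^ (2 * n - j)].
    The sum over all common levels, instead of the last one alone, suits both the induction and the
    exchange of sums in the energy. *)
Lemma sum_law_pair n (Q Q' : cube_index d M n) :
  \sum_(A : {set cube_index d M n} | (Q \in A) && (Q' \in A)) law A <=
  p ^+ (2 * n) * \sum_(j < n.+1) (ancestor hM j Q == ancestor hM j Q')%:R / p ^+ j.
Proof.
elim: n Q Q' => [|n IH] Q Q'.
  rewrite muln0 big_ord1 expr0 divr1 mul1r.
  rewrite (cube_index0 (ancestor hM _ Q) (ancestor hM _ Q')) eqxx.
  rewrite -(sum_level_law hC 0) big_mkcond; apply: ler_sum => A _.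
  by case: ifP => // _; exact: level_law_ge0.
have [<-|QQ'] := eqVneq Q Q'.
  under eq_bigl do rewrite andbb.
  rewrite sum_law_mem big_ord_recr/= eqxx mul1r mulrDr -[leLHS]add0r lerD//.
    rewrite mulr_ge0 ?exprn_ge0 ?(ltW p0)// sumr_ge0// => j _.
    by rewrite divr_ge0 ?exprn_ge0 ?(ltW p0)// ler0n.
  by rewrite mul2n -addnn exprD mulfK// expf_neq0// gt_eqF.
rewrite -(prob_level hC (fun A => (Q \in A) && (Q' \in A))).
rewrite (@total_probability _ _ _ P _ (C n)); first last.
- by move=> A; exact: (random_cantor_measurable hC).
- exact: (measurable_level hC (fun A => (Q \in A) && (Q' \in A))).
set S := ancestor hM n Q; set S' := ancestor hM n Q'.
apply: (@le_trans _ _ (\sum_(A : {set cube_index d M n} |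
    (S \in A) && (S' \in A)) law A * p ^+ 2)).
  rewrite [leRHS]big_mkcond; apply: ler_sum => A _.
  case: ifPn => [/andP[SA S'A]|SA]; first exact: (prob_children hN hC).
  rewrite le_eqVlt; apply/orP; left; apply/eqP.
  rewrite -[RHS](prob0 P); congr prob; apply/seteqP.
  split => // w [/= /andP[wQ wQ'] wA].
  have [Q1] := random_cantor_nested hC wQ.
  rewrite (subcubesE hM) wA => Q1A /eqP QE.
  have [Q2] := random_cantor_nested hC wQ'.
  rewrite (subcubesE hM) wA => Q2A /eqP QE'.
  by move: SA; rewrite /S /S' QE QE' Q1A Q2A.
rewrite -mulr_suml mulnS exprD -[leRHS]mulrA [leLHS]mulrC.
apply: ler_wpM2l; first by rewrite exprn_ge0// ltW.
apply: (le_trans (IH S S')).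
apply: ler_wpM2l; first by rewrite exprn_ge0// ltW.
rewrite [leRHS]big_ord_recr/= -[leLHS]addr0 lerD//; last first.
  by rewrite divr_ge0 ?exprn_ge0 ?(ltW p0)// ler0n.
by apply: ler_sum => j _; rewrite !ancestor_trans// leqnSn andbT -ltnS.
Qed.

End SecondMoment.

(** * Energy estimates and hitting probability *)

Section Energy.
Context {R : realType} {disp : measure_display} {T : measurableType disp}.
Context {P : probability T R} {d M N : nat} (hM : (1 < M)%N).
Context (hN : (1 <= N <= M ^ d)%N).
Context {C : forall n : nat, T -> {set cube_index d M n}}.
Context (hC : random_cantor P N C).
Context {n : nat} (m : cube_index d M n -> R) (c q r tau : R).
Context (m0 : forall Q, 0 <= m Q) (cm : c <= \sum_Q m Q) (c0 : 0 < c).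
Context (mq : forall k (Q : cube_index d M k), (k <= n)%N ->
  node_mass hM m Q <= q ^+ k).
Context (r0 : 0 < r) (r1 : r <= 1) (tau0 : 0 < tau) (tau1 : tau < 1).
Context (q0 : 0 <= q) (qrp : q <= r * @retention R d M N * tau ^+ 2).
Implicit Types (k : nat) (A : {set cube_index d M n}).
Local Notation family := (forall n, {set cube_index d M n}).

Local Notation p := (@retention R d M N).
Local Notation law := (level_law (P := P) (C := C)).

Let p0 : 0 < p. Proof. exact: retention_gt0. Qed.
Let p1 : p <= 1. Proof. exact: retention_le1. Qed.

Definition random_mass A k (Q : cube_index d M k) : R :=
  p ^- n * \sum_Q' (Q' \in A)%:R * (ancestor hM k Q' == Q)%:R * m Q'.

Definition total_mass A : R := p ^- n * \sum_Q (Q \in A)%:R * m Q.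

(** A discrete form of the Riesz [b]-energy of the random mass, for [r = M ^ -b]. *)
Definition energy A : R :=
  \sum_(k < n.+1) r ^- k * \sum_Q (random_mass A (k := k) Q) ^+ 2.

Lemma energy_ge0 A : 0 <= energy A.
Proof.
apply: sumr_ge0 => k _; rewrite mulr_ge0 ?invr_ge0 ?exprn_ge0 ?(ltW r0)//.
by apply: sumr_ge0 => Q _; exact: sqr_ge0.
Qed.

Lemma sum_law_indicator (f : {set cube_index d M n} -> bool) :
  \sum_A law A * (f A)%:R = \sum_(A | f A) law A.
Proof.
rewrite [RHS]big_mkcond; apply: eq_bigr => A _.
by case: (f A); rewrite ?mulr1 ?mulr0.
Qed.

Lemma total_mass_mean : c <= \sum_A law A * total_mass A.
Proof.
apply: (le_trans cm); rewrite le_eqVlt; apply/orP; left; apply/eqP.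
under [RHS]eq_bigr do rewrite /total_mass mulrCA.
rewrite -mulr_sumr; under [in RHS]eq_bigr do rewrite mulr_sumr.
rewrite exchange_big/= mulr_sumr; apply: eq_bigr => Q _.
under eq_bigr do rewrite mulrA; rewrite -mulr_suml sum_law_indicator.
by rewrite (sum_law_mem hM hN hC) mulrA mulVf ?mul1r// expf_neq0// gt_eqF.
Qed.

Lemma sum_mass_le1 : \sum_Q m Q <= 1.
Proof.
pose Q0 : cube_index d M 0 := address hM 0 (0 : 'rV[R]_d).
have := @mq 0 Q0 (leq0n n); rewrite expr0; apply: le_trans.
rewrite le_eqVlt; apply/orP; left; apply/eqP; apply: eq_bigl => Q.
by rewrite (cube_index0 (ancestor hM 0 Q) Q0) eqxx.
Qed.

Lemma total_mass_sqr_le A : total_mass A ^+ 2 <= energy A.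
Proof.
pose Q0 : cube_index d M 0 := address hM 0 (0 : 'rV[R]_d).
rewrite /energy big_ord_recl/= expr0 invr1 mul1r (bigD1 Q0)//= -addrA.
have -> : random_mass A Q0 = total_mass A.
  congr (_ * _); apply: eq_bigr => Q _.
  by rewrite (cube_index0 (ancestor hM 0 Q) Q0) eqxx mulr1.
rewrite lerDl addr_ge0//; first by apply: sumr_ge0 => Q _; exact: sqr_ge0.
apply: sumr_ge0 => k _; rewrite mulr_ge0 ?invr_ge0 ?exprn_ge0 ?(ltW r0)//.
by apply: sumr_ge0 => Q _; exact: sqr_ge0.
Qed.

Lemma sum_random_mass_sqr A k : \sum_Q (random_mass A (k := k) Q) ^+ 2 =
  p ^- (2 * n) * \sum_Q \sum_Q' ((Q \in A) && (Q' \in A))%:R *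
    ((ancestor hM k Q == ancestor hM k Q')%:R * (m Q * m Q')).
Proof.
under eq_bigr do rewrite /random_mass exprMn expr2 -invfM -exprD addnn -mul2n.
rewrite -mulr_sumr; congr (_ * _).
under eq_bigr do rewrite expr2 big_distrlr/=.
rewrite exchange_big/=; apply: eq_bigr => Q _.
rewrite exchange_big/=; apply: eq_bigr => Q' _.
rewrite (bigD1 (ancestor hM k Q))//= eqxx big1 ?addr0; last first.
  by move=> S /negbTE QS; rewrite eq_sym QS mulr0 !mul0r.
rewrite -mulnb natrM (eq_sym (ancestor hM k Q)) /=; ring.
Qed.

(** Pairs with common ancestors at levels [j] and [k] have one at the deeper level [l], where every
    cube has mass at most [q ^ l]; the total mass is at most 1. *)
Lemma pair_mass_le j k : (j <= n)%N -> (k <= n)%N ->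
  \sum_Q \sum_Q' (ancestor hM k Q == ancestor hM k Q')%:R *
    ((ancestor hM j Q == ancestor hM j Q')%:R * (m Q * m Q')) <= q ^+ maxn j k.
Proof.
move=> jn kn; set l := maxn j k.
have ln : (l <= n)%N by rewrite geq_max jn kn.
apply: (@le_trans _ _ (\sum_Q m Q * q ^+ l)); last first.
  rewrite -mulr_suml -[leRHS]mul1r ler_wpM2r ?exprn_ge0//.
  exact: sum_mass_le1.
apply: ler_sum => Q _.
apply: (@le_trans _ _ (m Q * node_mass hM m (ancestor hM l Q))); last first.
  by rewrite ler_wpM2l// mq.
rewrite /node_mass mulr_sumr [leRHS]big_mkcond; apply: ler_sum => Q' _.
have m2 : 0 <= m Q * m Q' by rewrite mulr_ge0.
case: ifPn => [_|lN].
  by do 2![case: eqP => _]; rewrite ?mul1r ?mul0r.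
suff : (ancestor hM k Q == ancestor hM k Q') && (ancestor hM j Q == ancestor hM j Q')
    = false.
  by case: eqP => _; [case: eqP => _ //|]; rewrite ?mul1r ?mul0r.
apply/negbTE; apply: contra lN => /andP[/eqP kE /eqP jE].
by rewrite /l /maxn; case: ifP => _; rewrite ?kE ?jE.
Qed.

Lemma weight_sum_le : \sum_(k < n.+1) tau ^+ k <= (1 - tau)^-1.
Proof.
have t1 : 0 < 1 - tau by rewrite subr_gt0.
rewrite -[leRHS]mul1r ler_pdivlMr// mulrC.
have := subrX1 tau n.+1; have := exprn_gt0 n.+1 tau0.
set S := \sum_(k < n.+1) tau ^+ k; move: (tau ^+ n.+1) => z z0 h.
have -> : (1 - tau) * S = 1 - z by rewrite -opprB mulNr -h opprB.
by rewrite gerBl ltW.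
Qed.

(** By [sum_law_pair] and [pair_mass_le], the mean is at most the sum of
    [r ^- k * p ^- j * q ^+ maxn j k]. The hypothesis on [q], with [r], [p] and [tau] at most 1,
    bounds the terms by [tau ^+ k * tau ^+ j]; the resulting bound is independent of [n]. *)
Lemma energy_mean : \sum_A law A * energy A <= (1 - tau)^-1 ^+ 2.
Proof.
have pn : 0 < p ^+ (2 * n) by exact: exprn_gt0.
have E1 : \sum_A law A * energy A = \sum_(k < n.+1) r ^- k * (p ^- (2 * n) *
    \sum_Q \sum_Q' (ancestor hM k Q == ancestor hM k Q')%:R * (m Q * m Q') *
      \sum_(A : {set cube_index d M n} | (Q \in A) && (Q' \in A)) law A).
  under eq_bigr do rewrite /energy mulr_sumr.
  rewrite exchange_big/=; apply: eq_bigr => k _.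
  under eq_bigr => A _ do
    rewrite sum_random_mass_sqr (mulrCA (law A)) (mulrCA (law A)).
  rewrite -mulr_sumr; congr (_ * _); rewrite -mulr_sumr; congr (_ * _).
  under [LHS]eq_bigr do rewrite mulr_sumr.
  rewrite exchange_big/=; apply: eq_bigr => Q _.
  under [LHS]eq_bigr do rewrite mulr_sumr.
  rewrite exchange_big/=; apply: eq_bigr => Q' _.
  under [LHS]eq_bigr => A _ do rewrite (mulrA (law A)).
  by rewrite -mulr_suml sum_law_indicator mulrC.
rewrite E1; apply: (@le_trans _ _ (\sum_(k < n.+1) \sum_(j < n.+1) tau ^+ k * tau ^+ j)).
  apply: ler_sum => k _.
  apply: (@le_trans _ _ (r ^- k * \sum_(j < n.+1) p ^- j * q ^+ maxn j k)).
    apply: ler_wpM2l; first by rewrite invr_ge0 exprn_ge0// ltW.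
    rewrite mulrC ler_pdivrMr//.
    apply: (@le_trans _ _ (\sum_Q \sum_Q' \sum_(j < n.+1) p ^+ (2 * n) * (p ^- j *
      ((ancestor hM k Q == ancestor hM k Q')%:R *
        ((ancestor hM j Q == ancestor hM j Q')%:R * (m Q * m Q')))))).
      apply: ler_sum => Q _; apply: ler_sum => Q' _.
      have m2 : 0 <= (ancestor hM k Q == ancestor hM k Q')%:R * (m Q * m Q').
        by rewrite !mulr_ge0 ?ler0n.
      apply: (le_trans (ler_wpM2l m2 (sum_law_pair hM hN hC Q Q'))).
      rewrite mulrCA !mulr_sumr le_eqVlt; apply/orP; left; apply/eqP.
      by apply: eq_bigr => j _; ring.
    under eq_bigr do rewrite exchange_big/=.
    rewrite exchange_big/= mulr_suml; apply: ler_sum => j _.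
    under eq_bigr => Q _ do rewrite -mulr_sumr -mulr_sumr.
    rewrite -mulr_sumr -mulr_sumr [leLHS]mulrC.
    apply: ler_wpM2r; first exact: ltW.
    apply: ler_wpM2l; first by rewrite invr_ge0 exprn_ge0// ltW.
    apply: pair_mass_le; first by rewrite -ltnS.
    by rewrite -ltnS.
  rewrite mulr_sumr; apply: ler_sum => j _.
  set l := maxn j k.
  have rl : r ^+ l <= r ^+ k by apply: ler_wiXn2l; rewrite ?(ltW r0)// leq_maxr.
  have pl : p ^+ l <= p ^+ j by apply: ler_wiXn2l; rewrite ?(ltW p0)// leq_maxl.
  have tk : tau ^+ l <= tau ^+ k.
    by apply: ler_wiXn2l; rewrite ?(ltW tau0) ?(ltW tau1)// leq_maxr.
  have tj : tau ^+ l <= tau ^+ j.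
    by apply: ler_wiXn2l; rewrite ?(ltW tau0) ?(ltW tau1)// leq_maxl.
  have rk0 : 0 < r ^+ k by exact: exprn_gt0.
  have pj0 : 0 < p ^+ j by exact: exprn_gt0.
  have tl0 : 0 <= tau ^+ l by rewrite exprn_ge0// ltW.
  apply: (@le_trans _ _ (tau ^+ l * tau ^+ l)); last exact: ler_pM.
  rewrite mulrA -invfM mulrC ler_pdivrMr ?mulr_gt0//.
  have ql : q ^+ l <= (r * p * tau ^+ 2) ^+ l.
    by apply: lerXn2r; rewrite ?nnegrE// (le_trans q0).
  apply: (le_trans ql).
  rewrite (exprMn l (r * p)) (exprMn l r p) expr2 (exprMn l tau) [leLHS]mulrC.
  apply: ler_wpM2l; first by rewrite mulr_ge0.
  by apply: ler_pM => //; rewrite exprn_ge0// ltW.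
under eq_bigr do rewrite -mulr_sumr.
rewrite -mulr_suml -expr2 lerXn2r ?nnegrE ?invr_ge0 ?subr_ge0 ?(ltW tau1)//.
  by apply: sumr_ge0 => k _; rewrite exprn_ge0// ltW.
exact: weight_sum_le.
Qed.

(** Chosen so that the bound on the mean energy, divided by it, is [c / 4]. *)
Definition energy_bound : R := 4 * (1 - tau)^-1 ^+ 2 / c.

Lemma energy_bound_gt0 : 0 < energy_bound.
Proof. by rewrite divr_gt0// mulr_gt0// exprn_gt0// invr_gt0 subr_gt0. Qed.

Definition good A : bool :=
  (c / 2 <= total_mass A) && (energy A <= energy_bound ^+ 2).

Lemma good_prob : c / (4 * energy_bound) <= \sum_(A | good A) law A.
Proof.
have l0 := energy_bound_gt0; set l := energy_bound in l0 *.
(* A second moment argument by truncation: a mass of at least [c / 2] is at most [l] when the energy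
   is at most [l ^ 2], and at most [energy A / l] otherwise. Taking means leaves at least [c / 4]
   for the last term. *)
have pt A : total_mass A <= c / 2 + energy A / l + l * (good A)%:R.
  have e0 := energy_ge0 A; have X2 := total_mass_sqr_le A.
  have el0 : 0 <= energy A / l by rewrite divr_ge0// ltW.
  rewrite /good -/l; case: (lerP (c / 2) (total_mass A)) => [Xc|Xc] /=; last first.
    by rewrite mulr0; lra.
  case: (lerP (energy A) (l ^+ 2)) => [el|el].
    rewrite mulr1n mulr1; suff : total_mass A <= l by move: c0; lra.
    by rewrite -(@ler_pXn2r _ 2) ?nnegrE ?(le_trans X2)// ltW//;
      move: c0; lra.
  rewrite mulr0 addr0; suff : total_mass A <= energy A / l by move: c0; lra.
  rewrite ler_pdivlMr//; have := sqr_ge0 (total_mass A - l); nra.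
have : c <= c / 2 + (1 - tau)^-1 ^+ 2 / l + l * \sum_(A | good A) law A.
  apply: (le_trans total_mass_mean).
  apply: (@le_trans _ _ (\sum_A law A * (c / 2 + energy A / l + l * (good A)%:R))).
    by apply: ler_sum => A _; rewrite ler_wpM2l ?level_law_ge0.
  under eq_bigr => A _ do
    rewrite mulrDr mulrDr (mulrA (law A) (energy A)) (mulrCA (law A) l).
  rewrite !big_split/= -mulr_suml (sum_level_law hC) mul1r lerD//.
    rewrite -mulr_suml lerD2l ler_wpM2r ?invr_ge0 ?(ltW l0)//.
    exact: energy_mean.
  by rewrite -mulr_sumr sum_law_indicator.
have -> : (1 - tau)^-1 ^+ 2 / l = c / 4.
  have : 0 < (1 - tau)^-1 ^+ 2 by rewrite exprn_gt0// invr_gt0 subr_gt0.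
  rewrite /l /energy_bound; move: (_ ^+ 2) => B B0.
  by field; rewrite !gt_eqF.
move=> h; have l4 : 0 < 4 * l by apply: mulr_gt0; [|exact: l0].
rewrite ler_pdivrMr//.
have -> : (\sum_(A | good A) law A) * (4 * l) = 4 * (l * \sum_(A | good A) law A).
  by ring.
move: h; set z := l * _ => h; lra.
Qed.

Lemma sum_random_mass A k (S : {set cube_index d M k}) :
  \sum_(Q in S) random_mass A Q =
  p ^- n * \sum_Q' (Q' \in A)%:R * (ancestor hM k Q' \in S)%:R * m Q'.
Proof.
rewrite /random_mass -mulr_sumr; congr (_ * _); rewrite exchange_big/=.
apply: eq_bigr => Q' _; rewrite -mulr_suml -mulr_sumr; congr (_ * _ * _).
have [QS|QS] := boolP (ancestor hM k Q' \in S).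
  rewrite (bigD1 (ancestor hM k Q'))//= eqxx big1 ?addr0// => Q /andP[_].
  by rewrite eq_sym => /negbTE ->.
rewrite big1// => Q QS'; case: eqP => // QE.
by rewrite QE QS' in QS.
Qed.

(** An energy form of the mass distribution principle: the cubes of a covering carry at least
    [c / 2] of mass, which bounded energy does not allow at small cost. *)
Lemma good_cost A (U : family) : good A ->
  (forall k, (n < k)%N -> U k = finset.set0) ->
  (forall Q, Q \in A -> m Q != 0 -> exists2 k, (k <= n)%N & ancestor hM k Q \in U k) ->
  ((c ^+ 2 / (4 * energy_bound ^+ 2))%:E <= cost r U)%E.
Proof.
have l0 := energy_bound_gt0; set l := energy_bound in l0 *.
move=> /andP[Xc el] U0 UA; rewrite -/l in el.
rewrite (@cost_finite _ _ _ _ _ n.+1 (ltW r0))// lee_fin.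
have XU : total_mass A <= \sum_(k < n.+1) \sum_(Q in U k) random_mass A Q.
  under eq_bigr do rewrite sum_random_mass.
  rewrite -mulr_sumr ler_wpM2l ?invr_ge0 ?exprn_ge0 ?(ltW p0)//.
  rewrite exchange_big/=; apply: ler_sum => Q _.
  have [->|mQ] := eqVneq (m Q) 0.
    by rewrite mulr0 sumr_ge0// => k _; rewrite mulr0.
  have [QA|QA] := boolP (Q \in A); last first.
    by rewrite mul0r sumr_ge0// => k _; rewrite !mul0r.
  have [k kn QU] := UA _ QA mQ.
  rewrite (bigD1 (Ordinal (kn : (k < n.+1)%N)))//= QU !mul1r lerDl.
  by apply: sumr_ge0 => j _; rewrite !mulr_ge0 ?ler0n.
(* With this value the energy term [energy A / (4 * la)] is at most [c / 4], half of the mass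
   available. *)
have [la laE] : exists la, la = l ^+ 2 / c by eexists.
have la0 : 0 < la by rewrite laE; apply: divr_gt0 => //; apply: exprn_gt0; exact: l0.
(* AM-GM: [x <= la * r ^ k + r ^ -k * x ^ 2 / (4 * la)] *)
have : total_mass A <= la * (\sum_(k < n.+1) r ^+ k * #|U k|%:R) +
    energy A / (4 * la).
  apply: (le_trans XU); rewrite mulr_sumr /energy mulr_suml -big_split/=.
  apply: ler_sum => k _.
  have rk : 0 < r ^+ k by exact: exprn_gt0.
  have -> : la * (r ^+ k * #|U k|%:R) = \sum_(Q in U k) la * r ^+ k.
    by rewrite sumr_const mulrA mulr_natr.
  rewrite (mulrAC (r ^- k)) mulr_sumr.
  apply: (@le_trans _ _ (\sum_(Q in U k) (la * r ^+ k +
      r ^- k / (4 * la) * random_mass A Q ^+ 2))).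
    apply: ler_sum => Q _; move: (random_mass A Q) => x.
    have a0 : 0 < la * r ^+ k by apply: mulr_gt0; [exact: la0|].
    have -> : r ^- k / (4 * la) = (4 * (la * r ^+ k))^-1.
      by rewrite -invfM; congr (_ ^-1); ring.
    move: (la * _) a0 => a a0; rewrite -subr_ge0.
    have -> : a + (4 * a)^-1 * x ^+ 2 - x = (2 * a - x) ^+ 2 / (4 * a).
      by field; rewrite gt_eqF.
    by rewrite divr_ge0 ?sqr_ge0// mulr_ge0// ltW.
  rewrite big_split/= lerD2l [leLHS]big_mkcond; apply: ler_sum => Q _.
  by case: ifP => // _; rewrite mulr_ge0 ?sqr_ge0// divr_ge0 ?invr_ge0 ?mulr_ge0 ?ltW.
set z := \sum_(k < n.+1) _ => h.
have e4 : energy A / (4 * la) <= c / 4.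
  rewrite ler_pdivrMr ?mulr_gt0//.
  have -> : c / 4 * (4 * la) = l ^+ 2 by rewrite laE; field; rewrite gt_eqF.
  exact: el.
have zc : c / 4 <= la * z by move: Xc h e4; lra.
have l4 : 0 < 4 * l ^+ 2.
  by apply: mulr_gt0 => //; apply: exprn_gt0; exact: l0.
rewrite ler_pdivrMr//.
have -> : z * (4 * l ^+ 2) = 4 * c * (la * z) by rewrite laE; field; rewrite gt_eqF.
by have : c * (c / 4) <= c * (la * z); [rewrite ler_wpM2l// ltW|rewrite expr2; lra].
Qed.

End Energy.

(** * From good finite levels to the limit set *)

Section Hitting.
Context {R : realType} {disp : measure_display} {T : measurableType disp}.
Context {P : probability T R} {d M N : nat} (hM : (1 < M)%N).
Context (hN : (1 <= N <= M ^ d)%N).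
Context {C : forall n : nat, T -> {set cube_index d M n}}.
Context (hC : random_cantor P N C).
Implicit Types (n k : nat) (K F : set 'rV[R]_d).
Local Notation family := (forall n, {set cube_index d M n}).
Local Notation p := (@retention R d M N).

Lemma cube_closed n (Q : cube_index d M n) : closed (cube Q : set 'rV[R]_d).
Proof.
rewrite (_ : cube Q = \bigcap_l ((fun x : 'rV[R]_d => x ord0 l) @^-1`
    `[(Q l)%:R * M%:R ^- n, (Q l).+1%:R * M%:R ^- n]%classic)).
  apply: closed_bigI => l _; apply: closed_comp; last exact: itv_closed.
  by move=> x _; exact: coord_continuous.
apply/seteqP; split => x /= Qx l; first by move=> _; rewrite /= in_itv/= Qx.
by have := Qx l I; rewrite /= in_itv.
Qed.

Lemma cubes_union_closed n (A : {set cube_index d M n}) :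
  closed (cubes_union A : set 'rV[R]_d).
Proof. by apply: closed_bigcup => [|Q _]; [exact: finite_finset|exact: cube_closed]. Qed.

Lemma cubes_union_nested n w :
  cubes_union (C n.+1 w) `<=` (cubes_union (C n w) : set 'rV[R]_d).
Proof.
move=> x [Q' /= Q'C Q'x]; have [Q QC] := random_cantor_nested hC Q'C.
rewrite (subcubesE hM) => /eqP QE; exists Q => //.
by rewrite -QE; apply: cube_ancestor Q'x.
Qed.

Lemma random_cantor_set_level n w x : unit_cube x ->
  (random_cantor_set C w : set 'rV[R]_d) x -> cubes_union (C n w) x.
Proof.
move=> xI; case: n => [_|n /(_ n.+1 (ltn0Sn _))//].
exists (address hM 0 x); last exact: cube_address.
by rewrite /= (random_cantor_init hC) inE.
Qed.

Lemma prob_limsup_ge (G : nat -> set T) (dl : R) : (forall n, measurable (G n)) ->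
  (forall n, dl%:E <= P (G n))%E ->
  (dl%:E <= P (\bigcap_n \bigcup_(j in [set j | (n <= j)%N]) G j))%E.
Proof.
move=> mG dG; pose F n := \bigcup_(j in [set j | (n <= j)%N]) G j.
have mF n : measurable (F n) by apply: bigcup_measurable.
have := @nonincreasing_cvg_mu _ _ _ P F.
move=> /(_ _ mF (bigcapT_measurable mF) _) h.
have {h}/cvg_lim <- // : (P \o F) n @[n --> \oo] --> P (\bigcap_n F n).
  apply: h; first by rewrite -ge0_fin_numE// fin_num_measure.
  apply/nonincreasing_seqP => n; apply/subsetPset => x [j /= nj Gx].
  by exists j => //=; exact: ltnW.
apply: lime_ge.
  apply: ereal_nonincreasing_is_cvgn => a b ab; apply: le_measure; rewrite ?inE//.
  by move=> x [j /= bj Gx]; exists j => //=; exact: leq_trans bj.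
apply: nearW => n; apply: (le_trans (dG n)); apply: le_measure; rewrite ?inE//.
by move=> x Gx; exists n => /=.
Qed.

(** The event is that infinitely many levels are good, so no limit of the mass distributions is
    taken. If the limit set were null, compactness would give a cheap finite covering of some level,
    hence of a later good level, against [good_cost]. The event is the same for all [t < b]. *)
Lemma hitting_probability (K : set 'rV[R]_d) (q tau c b : R) :
  closed K -> K `<=` unit_cube -> 0 < c -> (c%:E < content hM q K)%E ->
  0 <= q -> 0 < tau -> tau < 1 -> 0 < b ->
  q <= scale_weight b (M := M) * p * tau ^+ 2 ->
  exists A : set T, [/\ measurable A, (0 < P A)%E & forall w, A w ->
    forall t F, K `<=` F -> F `<=` unit_cube -> 0 <= t -> t < b ->
      hausdorff_measure t (random_cantor_set C w `&` F) <> 0%E].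
Proof.
move=> Kc KI c0 cK q0 tau0 tau1 b0 qrp; set rb := scale_weight b in qrp.
have rb0 : 0 < rb by exact: scale_weight_gt0.
have rb1 : rb <= 1.
  rewrite /rb /scale_weight powRN invf_le1 ?powR_gt0 ?ltr0n 1?ltnW//.
  by rewrite -[leLHS](powRr0 M%:R) ler_powR ?ler1n 1?ltnW// ltW.
have fr n := @finite_frostman _ _ _ hM q c n K q0 KI (ltW cK).
pose m n := projT1 (cid (fr n)).
have mP n := projT2 (cid (fr n)).
pose G n := [set w | good hM (m n) c rb tau (C n w) (N := N)].
have mG n : measurable (G n).
  exact: (measurable_level hC (fun A => good hM (m n) c rb tau A (N := N))).
have [l lE] : exists l, l = energy_bound c tau by eexists.
have l0 : 0 < l by rewrite lE; exact: energy_bound_gt0.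
have PG n : ((c / (4 * l))%:E <= P (G n))%E.
  have [m0 mK mq cm] := mP n.
  rewrite probE// lee_fin (prob_level hC (fun A => good hM (m n) c rb tau A (N := N))).
  rewrite lE; exact: (good_prob hN hC m0 cm c0 mq rb0 rb1 tau0 tau1 q0 qrp).
exists (\bigcap_n \bigcup_(j in [set j | (n <= j)%N]) G j); split.
- by apply: bigcapT_measurable => n; apply: bigcup_measurable.
- apply: lt_le_trans (prob_limsup_ge mG PG).
  by rewrite lte_fin divr_gt0// mulr_gt0.
move=> w Aw t F KF FI t0 tb HF.
pose L n := cubes_union (C n w) `&` K.
pose eta := c ^+ 2 / (4 * l ^+ 2).
have eta0 : 0 < eta by rewrite divr_gt0// ?mulr_gt0// exprn_gt0.
have [|||||n0 [U [U0 UL cU]]] := @hausdorff_null_compact_cover _ _ _ hM t b (eta / 2)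
  (random_cantor_set C w `&` F) L t0 tb _ HF.
- by rewrite divr_gt0.
- by move=> x [_ /FI].
- by move=> n; apply: closedI => //; exact: cubes_union_closed.
- by move=> n x [nx Kx]; split => //; exact: cubes_union_nested.
- move=> x [xI Lx]; split; first by move=> n _; have [] := Lx n I.
  by have [_ /KF] := Lx 0%N I.
have [n /= n0n Gn] := Aw n0 I.
have [m0 mK mq cm] := mP n.
have Ldec i j : (i <= j)%N -> L j `<=` L i.
  move=> /subnK <-; elim: (j - i)%N => [//|e IH] x; rewrite addSn => -[ex Kx].
  by apply: IH; split => //; exact: cubes_union_nested.
have : (eta%:E <= cost rb U)%E.
  rewrite /eta lE; apply: (good_cost hN m0 c0 rb0 tau1 Gn).
    by move=> k nk; apply: U0; exact: leq_trans n0n (ltnW nk).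
  move=> Q QC mQ; have [x Kx xQ] := mK _ mQ.
  have xI := KI _ Kx.
  have [k kU] : exists k, forall Q' : cube_index d M k, cube Q' x -> Q' \in U k.
    apply: UL; split => //; apply: (Ldec _ _ n0n); split => //.
    by exists Q => //; rewrite -xQ; exact: cube_address.
  have kn : (k <= n)%N.
    rewrite leqNgt; apply/negP => nk; have := kU _ (cube_address hM k xI).
    by rewrite U0 ?inE//; exact: leq_trans n0n (ltnW nk).
  by exists k => //; rewrite -xQ address_ancestor//; apply: kU; exact: cube_address.
by move=> /le_trans/(_ cU); rewrite lee_fin; lra.
Qed.

End Hitting.

(** * First moment estimates *)

Section Thinning.
Context {R : realType} {disp : measure_display} {T : measurableType disp}.
Context {P : probability T R} {d M N : nat} (hM : (1 < M)%N).
Context (hN : (1 <= N <= M ^ d)%N).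
Context {C : forall n : nat, T -> {set cube_index d M n}}.
Context (hC : random_cantor P N C).
Implicit Types (n k : nat) (F : set 'rV[R]_d) (r a e : R).
Local Notation family := (forall n, {set cube_index d M n}).
Implicit Types (U : family).
Local Notation p := (@retention R d M N).

(** Reaches an almost sure statement without measurability of [G]: the exceptional points lie in the
    intersection of the [B n]. *)
Lemma ae_of_small_exceptions (G : set T) :
  (forall e, 0 < e -> exists B, [/\ measurable B, (P B <= e%:E)%E & ~` B `<=` G]) ->
  {ae P, forall w, G w}.
Proof.
move=> GB; have /choice[B BP] n := GB n.+1%:R^-1 (ltac:(by rewrite invr_gt0)).
exists (\bigcap_n B n); split.
- by apply: bigcapT_measurable => n; have [] := BP n.
- apply/eqP; rewrite eq_le measure_ge0 andbT; apply/lee_addgt0Pr => e e0.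
  rewrite add0e; pose n := Num.truncn e^-1.
  have [mB PB _] := BP n; apply: (@le_trans _ _ (P (B n))).
    apply: le_measure; rewrite ?inE//; last exact: bigcap_inf.
    by apply: bigcapT_measurable => k; have [] := BP k.
  apply: (le_trans PB); rewrite lee_fin -[leRHS]invrK lef_pV2 ?posrE ?invr_gt0//.
  by rewrite ltW// truncnS_gt.
- move=> w nGw n _; apply: contrapT => nB; apply: nGw.
  by have [_ _] := BP n; apply.
Qed.

Let scaled_indic_mean (A : set T) a : measurable A -> 0 <= a ->
  (\int[P]_w (a%:E * (\1_A w)%:E) = a%:E * \int[P]_w (\1_A w)%:E)%E.
Proof.
move=> mA a0; apply: ge0_integralZl_EFin => //; last first.
  by apply/measurable_EFinP; exact: measurable_indic.
Qed.

Definition thinning U w : family := fun n => (U n :&: C n w)%SET.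

Let hit n (Q : cube_index d M n) : set T := [set w | Q \in C n w].

Let measurable_hit n (Q : cube_index d M n) : measurable (hit Q).
Proof. exact: (measurable_level hC (fun A => Q \in A)). Qed.

Lemma thinning_costE r U w : 0 <= r -> cost r (thinning U w) =
  (\sum_(0 <= n <oo) \sum_(Q <- fintype.enum (U n))
    (r ^+ n)%:E * (\1_(hit Q) w)%:E)%E.
Proof.
move=> r0; apply: eq_eseriesr => n _; rewrite big_enum/=.
rewrite -ge0_sume_distrr; last by move=> Q _; rewrite lee_fin.
rewrite sumEFin -EFinM; congr (_ * _)%:E.
rewrite -sum1_card natr_sum [LHS]big_mkcond [RHS]big_mkcond.
apply: eq_bigr => Q _; rewrite inE indicE /hit.
case: (Q \in U n) => //=; case: ifPn => QC; first by rewrite mem_set.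
by rewrite memNset//; apply/negP.
Qed.

Let measurable_term r n (Q : cube_index d M n) :
  measurable_fun setT
    ((fun w => (r ^+ n)%:E * (\1_(hit Q) w)%:E)%E : T -> \bar R).
Proof.
by apply: measurable_funeM; apply/measurable_EFinP; exact: measurable_indic.
Qed.

Let term_ge0 r n (Q : cube_index d M n) w : 0 <= r ->
  (0 <= (r ^+ n)%:E * (\1_(hit Q) w)%:E)%E.
Proof. by move=> r0; rewrite -EFinM lee_fin mulr_ge0// exprn_ge0. Qed.

Lemma measurable_thinning_cost r U : 0 <= r ->
  measurable_fun setT ((fun w => cost r (thinning U w)) : T -> \bar R).
Proof.
move=> r0; rewrite (_ : (fun w => _) = (fun w => \sum_(0 <= n <oo | n \in xpredT)
    \sum_(Q <- fintype.enum (U n)) (r ^+ n)%:E * (\1_(hit Q) w)%:E)%E).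
  apply: ge0_emeasurable_sum => [n w _ _|n _]; last first.
    by apply: emeasurable_sum => Q; exact: measurable_term.
  by apply: sume_ge0 => Q _; exact: term_ge0.
by apply/funext => w; rewrite thinning_costE//; exact: eq_eseriesl.
Qed.

Lemma thinning_cost_mean r U : 0 <= r ->
  (\int[P]_w cost r (thinning U w) = cost (r * p) U)%E.
Proof.
move=> r0; under eq_integral do rewrite thinning_costE//.
rewrite integral_nneseries//; first last.
- by move=> n w _; apply: sume_ge0 => Q _; exact: term_ge0.
- by move=> n; apply: emeasurable_sum => Q; exact: measurable_term.
apply: eq_eseriesr => n _; rewrite (ge0_integral_sum _ measurableT (fun Q : cube_index d M n => measurable_term r Q)
  (fun (Q : cube_index d M n) w _ => term_ge0 Q w r0)).
rewrite big_enum/= (eq_bigr (fun=> ((r * p) ^+ n)%:E)).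
  by rewrite sumEFin sumr_const mulr_natr.
move=> Q _; rewrite scaled_indic_mean ?exprn_ge0//.
rewrite integral_indic// setIT.
transitivity ((r ^+ n)%:E * P (hit Q))%E => //.
rewrite (probE _ (measurable_hit Q)).
rewrite /hit (prob_level hC (fun A => Q \in A)) (sum_law_mem hM hN hC).
by rewrite -EFinM (exprMn n r p).
Qed.

(** Markov's inequality, for the mean computed in [thinning_cost_mean]. *)
Lemma prob_thinning_cost_ge r a U : 0 <= r -> 0 < a ->
  measurable [set w | a%:E <= cost r (thinning U w)]%E /\
  (a%:E * P [set w | a%:E <= cost r (thinning U w)] <= cost (r * p) U)%E.
Proof.
move=> r0 a0; set B := [set w | _].
have mB : measurable B.
  rewrite (_ : B = (fun w => cost r (thinning U w)) @^-1` `[a%:E, +oo[%classic).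
    rewrite -[X in measurable X]setTI; apply: measurable_thinning_cost => //.
    exact: emeasurable_itv.
  by apply/seteqP; split => w /=; rewrite in_itv/= andbT.
split => //; rewrite -thinning_cost_mean// -[in leLHS](setIT B).
rewrite -integral_indic// -(scaled_indic_mean mB (ltW a0)).
apply: ge0_le_integral => //.
- by move=> w _; rewrite -EFinM lee_fin mulr_ge0// ltW.
- by apply: measurable_funeM; apply/measurable_EFinP; exact: measurable_indic.
- exact: measurable_thinning_cost.
move=> w _; rewrite indicE; have [wB|wB] := boolP (w \in B).
  by rewrite mule1; move: wB; rewrite inE.
by rewrite mule0; exact: cost_ge0.
Qed.

(** A point of the intersection lies in a surviving cube of the level at which the fat covering
    catches it; whichever cube this is, it belongs to the thinned family. *)
Lemma ae_thin_cover r a F : 0 <= r -> 0 < a -> F `<=` unit_cube ->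
  (forall e, 0 < e -> exists2 U : family, fat_cover U F &
    (cost (r * p) U <= e%:E)%E) ->
  {ae P, forall w, exists U : family, [/\
    forall x, (random_cantor_set C w `&` F) x ->
      exists n (Q : cube_index d M n), Q \in U n /\ cube Q x &
    (cost r U < a%:E)%E]}.
Proof.
move=> r0 a0 FI FU; apply: ae_of_small_exceptions => e e0.
have [U UF cU] := FU _ (mulr_gt0 a0 e0).
have [mB PB] := prob_thinning_cost_ge U r0 a0.
exists [set w | a%:E <= cost r (thinning U w)]%E; split => //.
  rewrite -(@lee_pmul2l _ a%:E)//.
  by rewrite (le_trans PB)// -EFinM.
move=> w /negP; rewrite -ltNge => aw; exists (thinning U w); split => // x [Ex Fx].
have [n nU] := UF _ Fx.
have [Q QC Qx] := random_cantor_set_level hM hC n (FI _ Fx) Ex.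
by exists n, Q; split => //; rewrite finset.in_setI nU.
Qed.

End Thinning.

(** * Dimension of the intersection *)

Section Dimension.
Context {R : realType} {disp : measure_display} {T : measurableType disp}.
Context {P : probability T R} {d M N : nat} (hM : (1 < M)%N).
Context (hN : (1 <= N <= M ^ d)%N).
Context {C : forall n : nat, T -> {set cube_index d M n}}.
Context (hC : random_cantor P N C).
Context {F : set 'rV[R]_d} (FI : F `<=` unit_cube).
Local Notation family := (forall n, {set cube_index d M n}).
Local Notation p := (@retention R d M N).
Local Notation s := (ln N%:R / ln M%:R : R).
Local Notation E := (random_cantor_set C).

Let M0 : (0 : R) < M%:R. Proof. by rewrite ltr0n ltnW. Qed.
Let lnM : 0 < ln (M%:R : R). Proof. by rewrite ln_gt0// ltr1n. Qed.

Let Mn0 : (M%:R : R) != 0. Proof. by rewrite gt_eqF. Qed.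

Lemma scale_weightD (a b : R) : scale_weight (a + b) (M := M) =
  scale_weight a (M := M) * scale_weight b (M := M).
Proof. by rewrite /scale_weight opprD powRD// Mn0 implybT. Qed.

Lemma scale_weight_lt1 (a : R) : 0 < a -> scale_weight a (M := M) < 1.
Proof.
move=> a0; rewrite /scale_weight /powR gt_eqF// expR_lt1.
by rewrite mulNr oppr_lt0 mulr_gt0.
Qed.

Lemma retention_weight : scale_weight (d%:R - s) (M := M) = p.
Proof.
have /andP[N0 _] := hN.
rewrite /scale_weight opprB powRB; last by rewrite Mn0 implybT.
rewrite powR_mulrn ?ltW// /retention natrX; congr (_ / _).
by rewrite /powR gt_eqF// divfK ?gt_eqF// lnK// posrE ltr0n.
Qed.

Lemma codimension_ge0 : 0 <= d%:R - s.
Proof.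
rewrite leNgt; apply/negP => ds.
have := @scale_weight_lt1 (- (d%:R - s)); rewrite oppr_gt0 => /(_ ds).
apply/negP; rewrite -leNgt.
have : scale_weight (- (d%:R - s)) (M := M) * p = 1.
  by rewrite -retention_weight -scale_weightD addNr /scale_weight oppr0 powRr0.
move=> h; rewrite -[leLHS]h ler_piMr ?powR_ge0//; exact: retention_le1.
Qed.

Lemma hausdorff_dim_lt (A : set 'rV[R]_d) (t : R) : (hausdorff_dim A < t%:E)%E ->
  exists t0, [/\ 0 <= t0, t0 < t & hausdorff_measure t0 A = 0%E].
Proof.
move=> /ereal_inf_lt[_ [t0 [t00 At0] <-]]; rewrite lte_fin => t0t.
by exists t0.
Qed.

Lemma hausdorff_dim_le (A : set 'rV[R]_d) (t : R) : 0 <= t ->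
  hausdorff_measure t A = 0%E -> (hausdorff_dim A <= t%:E)%E.
Proof. by move=> t0 At; apply: ereal_inf_lbound; exists t. Qed.

Lemma hausdorff_measure_set0 (t : R) : 0 < t ->
  hausdorff_measure t (set0 : set 'rV[R]_d) = 0%E.
Proof.
move=> t0; apply: (hausdorff_null_of_cubes hM t0) => e e0.
exists (fun n => finset.set0) => //.
by rewrite (@cost_finite _ _ _ _ _ 0) ?powR_ge0// big_ord0 lee_fin ltW.
Qed.

(** For [r = 1] the cost counts the surviving cubes of the covering, so a cost below 1 leaves
    none. *)
Lemma ae_disjoint : (hausdorff_dim F < (d%:R - s)%:E)%E ->
  {ae P, forall w, E w `&` F = set0}.
Proof.
move=> /hausdorff_dim_lt[t0 [t00 t0t Ft0]].
have := @ae_thin_cover _ _ _ P _ _ _ hM hN _ hC 1 1 F ler01 ltr01 FI.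
rewrite mul1r -retention_weight.
move=> /(_ (fun e e0 => hausdorff_null_fat_cover hM t00 t0t e0 FI Ft0)).
apply: filterS => w [U [UE U1]]; apply/seteqP; split => // x /UE[n [Q [QU _]]].
exfalso; move: U1; apply/negP; rewrite -leNgt.
apply: (@le_trans _ _ (1 ^+ n * #|U n|%:R)%:E).
  by rewrite expr1n mul1r lee_fin ler1n card_gt0; apply/finset.set0Pn; exists Q.
apply: (le_nneseries_term (u := fun n => (1 ^+ n * #|U n|%:R)%:E)) => i.
by rewrite lee_fin mulr_ge0// exprn_ge0.
Qed.

Lemma ae_hausdorff_dim_le (u : R) : 0 < u ->
  (hausdorff_dim F < (u + (d%:R - s))%:E)%E ->
  {ae P, forall w, (hausdorff_dim (E w `&` F) <= u%:E)%E}.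
Proof.
move=> u0 /hausdorff_dim_lt[t0 [t00 t0t Ft0]].
have aeU i := @ae_thin_cover _ _ _ P _ _ _ hM hN _ hC (scale_weight u (M := M))
  i.+1%:R^-1 F (powR_ge0 _ _) (ltac:(by rewrite invr_gt0)) FI.
rewrite -retention_weight -scale_weightD in aeU.
have {}aeU i := aeU i (fun e e0 => hausdorff_null_fat_cover hM t00 t0t e0 FI Ft0).
have := ae_foralln aeU; apply: filterS => w Uw.
apply: hausdorff_dim_le; first exact: ltW.
apply: (hausdorff_null_of_cubes hM u0) => e e0.
have [U [UE cU]] := Uw (Num.truncn e^-1); exists U => //.
apply: (le_trans (ltW cU)).
rewrite lee_fin -[leRHS]invrK lef_pV2 ?posrE ?invr_gt0//.
by rewrite ltW// truncnS_gt.
Qed.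

Lemma hausdorff_dim_ge_event (b : R) : borel_set F -> 0 < b ->
  ((b + (d%:R - s))%:E < hausdorff_dim F)%E ->
  exists A : set T, [/\ measurable A, (0 < P A)%E & forall w, A w ->
    E w `&` F !=set0 /\ (b%:E <= hausdorff_dim (E w `&` F))%E].
Proof.
move=> bF b0.
(* One gap [g] is spent in passing to a compact subset of positive [t]-content, the other one on the
   geometric decay in the energy. *)
have [g g0 gF] : exists2 g : R, 0 < g &
    ((b + (d%:R - s))%:E < hausdorff_dim F)%E ->
    ((b + (d%:R - s) + g + g)%:E < hausdorff_dim F)%E.
  case: (hausdorff_dim F) => [a| |].
  - exists (if b + (d%:R - s) < a then (a - (b + (d%:R - s))) / 3 else 1).
      by case: (ltP (b + (d%:R - s)) a) => // h; rewrite divr_gt0// subr_gt0.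
    rewrite !lte_fin; set z := b + _ => h; rewrite h; lra.
  - by exists 1 => // _; rewrite ltry.
  - by exists 1.
move=> {gF}/gF; set t := b + (d%:R - s) + g => tF.
have t0 : 0 < t by have := codimension_ge0; rewrite /t; lra.
have Ft : hausdorff_measure (t + g) F <> 0%E.
  have tg0 : 0 <= t + g by rewrite addr_ge0// ltW.
  by move=> /(hausdorff_dim_le tg0); rewrite leNgt tF.
have [|K [c [Kc KF c0 cK]]] := borel_compact_content hM t0 _ bF FI Ft.
  by rewrite ltrDl.
(* With [tau = M ^ (- (g / 2))], the condition on [q = M ^ -t] is an equality, as
   [t = b + (d - s) + g]. *)
have [||||||A [mA PA AF]] := @hitting_probability _ _ _ P _ _ _ hM hN _ hC K
  (scale_weight t (M := M)) (scale_weight (g / 2) (M := M)) c b Kc _ c0 cK.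
- exact: subset_trans FI.
- exact: powR_ge0.
- exact: scale_weight_gt0.
- by apply: scale_weight_lt1; rewrite divr_gt0.
- exact: b0.
- by rewrite -retention_weight expr2 -!scale_weightD -splitr.
exists A; split => // w Aw; split.
  apply/set0P/negP => /eqP EF0.
  apply: (AF w Aw (b / 2) F KF FI); rewrite ?EF0; [lra|lra|].
  by apply: hausdorff_measure_set0; lra.
apply: le_ereal_inf_tmp => _ [t1 [t10 Et1] <-]; rewrite lee_fin leNgt.
by apply/negP => t1b; exact: (AF w Aw t1 F KF FI).
Qed.

Lemma ess_sup_hausdorff_dim (alpha : R) : borel_set F ->
  hausdorff_dim F = alpha%:E -> d%:R - s < alpha ->
  ess_sup P (fun w => hausdorff_dim (E w `&` F)) = (alpha + s - d%:R)%:E.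
Proof.
move=> bF Fa sa; set gm := alpha + s - d%:R.
have gm0 : 0 < gm by rewrite /gm; lra.
apply/eqP; rewrite eq_le; apply/andP; split; apply/lee_addgt0Pr => e e0.
  apply/ess_supP; rewrite -EFinD; apply: ae_hausdorff_dim_le; first by lra.
  by rewrite Fa lte_fin /gm; lra.
(* The second term keeps [b] positive when [e] is large. *)
pose b := Num.max (gm - e) (gm / 2).
have b0 : 0 < b by rewrite lt_max divr_gt0// orbT.
have bgm : b < gm by rewrite gt_max; apply/andP; split; lra.
have be : gm <= b + e by rewrite -lerBlDr le_max lexx.
have [|A [mA PA AF]] := hausdorff_dim_ge_event bF b0.
  by rewrite Fa lte_fin; move: bgm; rewrite /gm; lra.
suff : (b%:E <= ess_sup P (fun w => hausdorff_dim (E w `&` F)))%E.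
  by move=> /(leeD2r e%:E); apply: le_trans; rewrite -EFinD lee_fin.
rewrite leNgt; apply/negP => h.
have [B [mB PB BF]] := ess_sup_ge P (fun w => hausdorff_dim (E w `&` F)).
have : (P A <= P B)%E.
  apply: le_measure; rewrite ?inE// => w Aw; apply: BF => /= hw.
  have [_ bw] := AF w Aw.
  by have := le_lt_trans (le_trans bw hw) h; rewrite ltxx.
by rewrite PB leNgt PA.
Qed.

End Dimension.

Unset Implicit Arguments.

Theorem theorem1p6 (R : realType) (disp : measure_display)
    (T : measurableType disp) (P : probability T R)
    (d M N : nat) (hd : (1 <= d)%N) (hM : (2 <= M)%N)
    (hN : (1 <= N <= M ^ d)%N)
    (C : forall n : nat, T -> {set cube_index d M n})
    (hC : random_cantor P N C)
    (F : set 'rV[R]_d) (hF : borel_set F) (hF1 : F `<=` unit_cube)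
    (alpha : R) (halpha : hausdorff_dim F = alpha%:E) :
  let E : T -> set 'rV[R]_d := random_cantor_set C in
  let s : R := ln N%:R / ln M%:R in
  [/\ alpha < d%:R - s -> {ae P, forall w, E w `&` F = set0},
      d%:R - s < alpha ->
        exists A : set T, [/\ measurable A, (0 < P A)%E &
          forall w, A w -> E w `&` F !=set0]
    & d%:R - s < alpha ->
        ess_sup P (fun w => hausdorff_dim (E w `&` F)) =
          (alpha + s - d%:R)%:E].
Proof.
move=> E s; split.
- move=> alpha_lt; apply: (ae_disjoint hM hN hC hF1).
  by rewrite halpha lte_fin.
- move=> alpha_gt; set b := (alpha - (d%:R - s)) / 2.
  have b0 : 0 < b by rewrite divr_gt0// subr_gt0.
  have [|A [mA PA AF]] := hausdorff_dim_ge_event hM hN hC hF1 hF b0.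
    by rewrite halpha lte_fin; move: b0; rewrite /b -/s; lra.
  by exists A; split => // w /AF[].
- exact: (ess_sup_hausdorff_dim hM hN hC hF1 hF halpha).
Qed.
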